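(* Let $M$ be an $n$-dimensional complex manifold which is infinitesimally Kobayashi non-degenerate, and let $f:M\to\mathbb{C}$ be holomorphic. Then the following are equivalent: (i) $f$ is semi-Bloch on $M$; (ii) for each line $L$ in the complex plane, $$M_L=\sup\left\{\frac{|f_*(z)(\xi)|}{k_M(z,\xi)} : z\in M,\ f(z)\in L,\ \xi\in T_z(M)\right\}<\infty;$$ (iii) for each line $L$ in the complex plane, $$D_L=\sup\{d_f(z): z\in M,\ f(z)\in L\}<\infty.$$
   Context: $\mathbb{D}$ is the open unit disk in $\mathbb{C}$; $\hat{\mathbb{C}}$ is the Riemann sphere; $T_z(M)$ is the complex tangent space of $M$ at $z$; $f_*(z):T_z(M)\to T_{f(z)}(N)$ is the differential at $z$ of a holomorphic map $f:M\to N$ between complex manifolds. A line in $\mathbb{C}$ is a real affine line. An analytic disk in $M$ is a holomorphic map $\phi:\mathbb{D}\to M$; $\phi'(\zeta)=\phi_*(\zeta)(e)$ with $e$ the canonical basis vector of the tangent space of $\mathbb{D}$ (identified with $\mathbb{C}$). The infinitesimal Kobayashi-Royden pseudometric is, for $z\in M$, $\xi\in T_z(M)$, $$k_M(z,\xi)=\inf\left\{\frac{1}{|a|} : \phi \text{ is an analytic disk in } M,\ \phi(0)=z,\ \phi'(0)=a\xi\right\}.$$ $M$ is infinitesimally Kobayashi non-degenerate if $k_M(z,\xi)>0$ for all $z\in M$ and $\xi\in T_z(M)\setminus\{0\}$. The infinitesimal spherical metric on $\hat{\mathbb{C}}$ is $\chi(w,\eta)=\frac{2|\eta|}{1+|w|^2}$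 (extended to $w=\infty$ via the coordinate $1/w$). A meromorphic function $g:M\to\hat{\mathbb{C}}$ (a holomorphic map into the Riemann sphere) is normal if there is a constant $C$ such that $\chi(g(z),g_*(z)(\xi))\le C\,k_M(z,\xi)$ for all $z\in M$, $\xi\in T_z(M)$. A holomorphic function $f:M\to\mathbb{C}$ is semi-Bloch if for every $\lambda\in\mathbb{C}$ the function $g_\lambda(z)=\exp(\lambda f(z))$ is normal on $M$. For $w_0\in\mathbb{C}$ and $r>0$, the disk $\mathbb{D}(w_0,r)=\{w\in\mathbb{C}:|w-w_0|<r\}$ is a schlicht disk in the range of $f$ if there is a holomorphic map $h:\mathbb{D}\to M$ such that $f\circ h:\mathbb{D}\to\mathbb{D}(w_0,r)$ is biholomorphic. For $z\in M$, $d_f(z)=\sup\{r:\mathbb{D}(f(z),r)\text{ is a schlicht disk in the range of } f\}$. Conventions: a quotient $0/0$ (as occurs for $\xi=0$) is read as $0$, and the supremum of an empty set of nonnegative quantities is $0$. *)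

(* Defs.v *)
From HB Require Import structures.
From mathcomp Require Import all_boot all_order all_algebra.
From mathcomp Require Import complex.
From mathcomp Require Import all_classical all_reals all_analysis.

Set Implicit Arguments.
Unset Strict Implicit.
Unset Printing Implicit Defensive.

Import Order.TTheory GRing.Theory Num.Theory.
Import numFieldNormedType.Exports.

Local Open Scope classical_set_scope.
Local Open Scope ring_scope.
Local Open Scope complex_scope.

(* R[i] as a normed module over itself, so that [differentiable] and ['d]
   between normed R[i]-modules mean complex differentiability. *)
HB.instance Definition _ (R : rcfType) := GRing.ComAlgebra.copy R[i] R[i]^o.
HB.instance Definition _ (R : rcfType) := Vector.copy R[i] R[i]^o.
HB.instance Definition _ (R : rcfType) := NormedModule.copy R[i] R[i]^o.

(* The library norm `|z| of z : R[i] lies in R[i]; [cabs z] is its value in R. *)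
Notation cabs := ComplexField.Normc.normc.

Section ComplexNumbers.
Variable R : realType.

Lemma cabsE (z : R[i]) : `|z| = (cabs z)%:C.
Proof. by []. Qed.

Definition disk (w0 : R[i]) (r : R) : set R[i] := [set w | cabs (w - w0) < r].

Definition unit_disk : set R[i] := disk 0 1.

Definition expC (z : R[i]) : R[i] :=
  (expR (complex.Re z))%:C * (cos (complex.Im z) +i* sin (complex.Im z)).

Definition is_line (L : set R[i]) : Prop :=
  exists a b : R[i], b != 0 /\ L = [set a + t%:C * b | t in [set: R]].

(* The supremum of a set of nonnegative extended reals, with sup set0 = 0
   (the library has [ereal_sup set0 = -oo]). *)
Definition nnsup (A : set (\bar R)) : \bar R := ereal_sup (0%E |` A).

Lemma nbhs_diskP (w : R[i]) (A : set R[i]) :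
  nbhs w A <-> exists2 e : R, 0 < e & disk w e `<=` A.
Proof.
split.
- move=> /nbhs_ballP[[e e'] /=].
  rewrite ltcE /= => /andP[/eqP -> e0] sA; exists e => // z.
  rewrite /disk /= => zw; apply: sA; rewrite -ball_normE /= distrC cabsE ltcR.
  exact: zw.
- move=> [e e0 sA]; apply/nbhs_ballP; exists e%:C; rewrite /= ?ltcR // => z.
  rewrite -ball_normE /= distrC cabsE ltcR; exact: sA.
Qed.

Lemma near_neq0 (w : R[i]) : w != 0 -> \forall z \near w, z != 0.
Proof.
move=> w0; apply/nbhs_diskP; exists (cabs w).
  by rewrite -ltcR -cabsE normr_gt0.
move=> z; rewrite /disk /mkset => zw; apply/eqP => z0; move: zw.
by rewrite z0 sub0r normcN ltxx.
Qed.

Lemma cabs_continuous : continuous (fun z : R[i] => cabs z : R).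
Proof.
move=> w; apply/(@cvgrPdist_lt _ R _ (nbhs w) _) => e e0.
apply/nbhs_diskP; exists e => // z.
rewrite /disk /=; apply: le_lt_trans; have := ler_dist_dist w z.
rewrite ![`|_ : R[i]|]cabsE lecR -rmorphB /= expr0n addr0 sqrtr_sqr.
by move=> h; rewrite -[leRHS]normcN opprB.
Qed.

Lemma closed_cabs (r : R) : closed [set w : R[i] | cabs w <= r].
Proof.
apply: (preimage_closed _ (@closed_le R r)) => y _; exact: cabs_continuous.
Qed.

Lemma compact_cabs (r : R) : compact [set w : R[i] | cabs w <= r].
Proof.
pose J : R * R -> R[i] := fun p => p.1 +i* p.2.
have cJ : continuous J.
  move=> [x y] A /nbhs_diskP[e e0 sA].
  have e20 : 0 < e / 2 by rewrite divr_gt0.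
  exists (ball x (e / 2), ball y (e / 2)).
    by split; exact: nbhsx_ballx.
  move=> [x' y'] [] /=; rewrite -!ball_normE /= => xx' yy'; apply: sA.
  rewrite /disk /mkset -ltcR -cabsE.
  have -> : J (x', y') - J (x, y) = (x' - x)%:C + 'i * (y' - y)%:C.
    by rewrite /J /=; simpc.
  apply: (le_lt_trans (ler_normD _ _)).
  have nC (x1 : R) : `|x1%:C : R[i]| = `|x1|%:C.
    by rewrite normc_def /= expr0n addr0 sqrtr_sqr.
  have ni : `|'i : R[i]| = 1 by rewrite normc_def /= expr0n expr1n add0r sqrtr1.
  rewrite normrM ni mul1r !nC -rmorphD ltcR [ltRHS]splitr.
  by rewrite ltrD // distrC.
apply: (@subclosed_compact _ _ (J @` (`[-r, r] `*` `[-r, r]))).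
- exact: closed_cabs.
- apply: continuous_compact; first exact: continuous_subspaceT.
  by apply: compact_setX; exact: segment_compact.
- move=> [a b] /= ab; exists (a, b) => //; split; rewrite /= in_itv /= -ler_norml.
    by apply: le_trans ab; rewrite -[leLHS]sqrtr_sqr ler_wsqrtr // lerDl sqr_ge0.
  by apply: le_trans ab; rewrite -[leLHS]sqrtr_sqr ler_wsqrtr // lerDr sqr_ge0.
Qed.

Lemma compact_cabs_bounded (K : set R[i]) : compact K ->
  exists2 r : R, 0 < r & forall w, K w -> cabs w < r.
Proof.
move=> cK; have : compact ((fun z : R[i] => cabs z : R) @` K).
  apply: continuous_compact => //; apply: continuous_subspaceT.
  exact: cabs_continuous.
move=> /(@compact_bounded R R) [B [_ /(_ (`|B| + 1))]].
rewrite (le_lt_trans (ler_norm B)) ?ltrDl // => /(_ isT) hB.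
exists (`|B| + 2) => [|w Kw]; first by rewrite ltr_wpDl.
have /le_lt_trans -> // : cabs w <= `|B| + 1.
  by apply: le_trans (ler_norm _) _; apply: hB; exists w.
by rewrite ltrD2l ltr1n.
Qed.

Local Notation sphere := (one_point_compactification R[i]).

Lemma nbhs_inftyP (A : set sphere) : nbhs (None : sphere) A <->
  A None /\ exists2 r : R, 0 < r & forall w, r <= cabs w -> A (Some w).
Proof.
split.
- move=> nA; split; first exact: (nbhs_singleton nA).
  move: nA => [K [cK _] sA]; have [r r0 hr] := compact_cabs_bounded cK.
  exists r => // w rw; apply: sA; left; exists w => // /hr.
  by rewrite ltNge rw.
- move=> [AN [r r0 hr]]; exists [set w : R[i] | cabs w <= r].
    by split; [exact: compact_cabs|exact: closed_cabs].
  move=> _ [[w wr <-]|->//]; apply: hr.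
  by rewrite leNgt; apply/negP => /ltW.
Qed.

End ComplexNumbers.

Arguments unit_disk : clear implicits.

Section Manifolds.
Variable R : realType.

(* A homeomorphism [chart_coord] from the open set [chart_dom] onto an open
   subset of the model space, with inverse [chart_param]; both are total
   functions, whose values elsewhere are irrelevant. *)
Record chart (T : topologicalType) (V : normedModType R[i]) := Chart {
  chart_dom : set T;
  chart_coord : T -> V;
  chart_param : V -> T;
  dom_open : open chart_dom;
  codom_open : open (chart_coord @` chart_dom);
  coordK : forall x, chart_dom x -> chart_param (chart_coord x) = x;
  coord_continuous : {in chart_dom, continuous chart_coord};
  param_continuous : {in chart_coord @` chart_dom, continuous chart_param} }.

Definition holomorphic_transition (T : topologicalType) (V : normedModType R[i])
    (c d : chart T V) : Prop :=
  forall x, chart_dom c x -> chart_dom d x ->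
    differentiable (chart_coord d \o chart_param c) (chart_coord c x).

(* A holomorphic atlas, indexed by the points of the space so that every point
   has a preferred chart around it. *)
Record complexAtlas (V : normedModType R[i]) := ComplexAtlas {
  carrier :> topologicalType;
  chart_at : carrier -> chart carrier V;
  chart_at_dom : forall x, chart_dom (chart_at x) x;
  chart_at_holo : forall x y,
    holomorphic_transition (chart_at x) (chart_at y) }.

Record complexManifold (V : normedModType R[i]) := ComplexManifold {
  atlas :> complexAtlas V;
  manifold_hausdorff : hausdorff_space atlas;
  manifold_second_countable : @second_countable atlas }.

Section Maps.
Variables V W : normedModType R[i].
Variables (M : complexAtlas V) (N : complexAtlas W).

Definition in_charts (f : M -> N) (x : M) (y : N) : V -> W :=
  chart_coord (chart_at y) \o f \o chart_param (chart_at x).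

(* Used for open U only; the values of f outside U are irrelevant. *)
Definition holomorphic_on (f : M -> N) (U : set M) : Prop :=
  {in U, continuous f} /\
  forall (x : M) (y : N) (z : M), U z ->
    chart_dom (chart_at x) z -> chart_dom (chart_at y) (f z) ->
    differentiable (in_charts f x y) (chart_coord (chart_at x) z).

Definition holomorphic (f : M -> N) : Prop := holomorphic_on f [set: M].

End Maps.

(* A tangent vector at z is given by its components in the preferred chart at
   z, and the differential f_*(z) by the derivative of f in the preferred
   charts at z and f z. *)
Definition tangent (V : normedModType R[i]) (M : complexAtlas V) (z : M) :
  normedModType R[i] := V.

Definition differential (V W : normedModType R[i]) (M : complexAtlas V)
    (N : complexAtlas W) (f : M -> N) (z : M) :
    tangent z -> tangent (f z) :=
  'd (in_charts f z (f z)) (chart_coord (chart_at z) z).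

Definition biholomorphic (V W : normedModType R[i]) (M : complexAtlas V)
    (N : complexAtlas W) (f : M -> N) (A : set M) (B : set N) : Prop :=
  exists g : N -> M,
    [/\ holomorphic_on f A, holomorphic_on g B,
        (forall x, A x -> B (f x) /\ g (f x) = x) &
        (forall y, B y -> A (g y) /\ f (g y) = y)].

End Manifolds.

Section ComplexPlane.
Variable R : realType.

Fact plane_codom : open (id @` [set: R[i]]).
Proof. by rewrite image_id; exact: openT. Qed.

Fact plane_continuous (A : set R[i]) : {in A, continuous (id : R[i] -> R[i])}.
Proof. by move=> x _ B. Qed.

Definition plane_chart : chart R[i] R[i] :=
  Chart openT plane_codom (fun x _ => erefl)
    (@plane_continuous _) (@plane_continuous _).

Fact plane_chart_holo (x y : R[i]) :
  holomorphic_transition plane_chart plane_chart.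
Proof. by []. Qed.

Definition complex_plane : complexAtlas R[i] :=
  @ComplexAtlas R R[i] R[i] (fun=> plane_chart) (fun=> I) plane_chart_holo.

End ComplexPlane.

Section RiemannSphere.
Variable R : realType.
Local Notation sphere := (one_point_compactification R[i]).

(* The coordinates w, on the complement of infinity, and 1/w, on the complement
   of 0; their values elsewhere are irrelevant. *)
Definition fin_coord (x : sphere) : R[i] := if x is Some w then w else 0.

Definition inf_coord (x : sphere) : R[i] := if x is Some w then w^-1 else 0.

Definition inf_param (u : R[i]) : sphere := if u == 0 then None else Some u^-1.

Fact fin_open : open (range Some : set sphere).
Proof. exact/one_point_compactification_open_some/openT. Qed.

Fact fin_codom : open (fin_coord @` range Some).
Proof.
rewrite (_ : _ @` _ = setT); first exact: openT.
by apply/seteqP; split=> // w _; exists (Some w) => //; exists w.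
Qed.

Fact fin_coordK x : range Some x -> Some (fin_coord x) = x.
Proof. by move=> [w _ <-]. Qed.

Fact fin_coord_continuous : {in range Some, continuous fin_coord}.
Proof. by move=> x /set_mem [w _ <-] A. Qed.

Fact fin_param_continuous :
  {in fin_coord @` range Some, continuous (Some : R[i] -> sphere)}.
Proof. by move=> w _; exact: one_point_compactification_some_continuous. Qed.

Definition fin_chart : chart sphere R[i] :=
  Chart fin_open fin_codom fin_coordK fin_coord_continuous
    fin_param_continuous.

Let nzs : set sphere := [set x | x <> Some 0].

Fact inf_open : open nzs.
Proof.
rewrite openE => -[w /= w0|_].
  have {}w0 : w != 0 by apply: contra_notN w0 => /eqP ->.
  by apply: filterS (near_neq0 w0) => z /eqP z0 [].
by apply/nbhs_inftyP; split=> //; exists 1 => // w w1 [] w0; move: w1;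
  rewrite w0 ComplexField.Normc.normc0 ler10.
Qed.

Fact inf_coordK x : nzs x -> inf_param (inf_coord x) = x.
Proof.
case: x => [w|_]; rewrite /nzs /inf_param /= ?eqxx // => w0.
by rewrite invr_eq0 invrK ifN //; apply: contra_notN w0 => /eqP ->.
Qed.

Fact inf_paramK u : inf_coord (inf_param u) = u.
Proof. by rewrite /inf_param; case: eqP => [->|_] //=; rewrite invrK. Qed.

Fact inf_codom : open (inf_coord @` nzs).
Proof.
rewrite (_ : _ @` _ = setT); first exact: openT.
apply/seteqP; split=> // u _; exists (inf_param u); last exact: inf_paramK.
by rewrite /nzs /inf_param /=; case: eqP => // /eqP u0 [] /eqP; rewrite invr_eq0 (negbTE u0).
Qed.

Fact inf_coord_continuous : {in nzs, continuous inf_coord}.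
Proof.
move=> [w|] /set_mem; rewrite /nzs /= => w0 A.
  have {}w0 : w != 0 by apply: contra_notN w0 => /eqP ->.
  exact: (inv_continuous w0).
move=> /nbhs_diskP[e e0 sA]; apply/nbhs_inftyP; split.
  by apply: sA; rewrite /disk /mkset subrr ComplexField.Normc.normc0.
exists (e / 2)^-1 => [|w ew]; first by rewrite invr_gt0 divr_gt0.
apply: sA; rewrite /disk /mkset subr0 ComplexField.Normc.normcV.
have h : 0 < cabs w by apply: lt_le_trans ew; rewrite invr_gt0 divr_gt0.
apply: (@le_lt_trans _ _ (e / 2)); last by rewrite ltr_pdivrMr // ltr_pMr // ltr1n.
by rewrite invf_ple // posrE // divr_gt0.
Qed.

Fact inf_param_continuous : {in inf_coord @` nzs, continuous inf_param}.
Proof.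
move=> u _ A; have [->|u0] := eqVneq u 0.
  rewrite {1}/inf_param eqxx => /nbhs_inftyP [AN [r r0 hr]].
  apply/nbhs_diskP; exists r^-1; rewrite ?invr_gt0 // => v.
  rewrite /disk /= subr0 /inf_param => vr; case: eqP => // /eqP v0; apply: hr.
  rewrite ComplexField.Normc.normcV.
  have h : 0 < cabs v by rewrite -ltcR -cabsE normr_gt0.
  by rewrite -[r]invrK lef_pV2 ?posrE ?invr_gt0 // ltW.
rewrite {1}/inf_param (negbTE u0) => nA.
have nz : \forall v \near u, v != 0 by exact: near_neq0.
apply: filterS2 nz (inv_continuous u0 nA) => v v0 /=.
by rewrite /inf_param (negbTE v0).
Qed.

Definition inf_chart : chart sphere R[i] :=
  Chart inf_open inf_codom inf_coordK inf_coord_continuous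
    inf_param_continuous.

(* The preferred coordinate is w on the finite part and 1/w at infinity. *)
Definition sphere_chart (x : sphere) : chart sphere R[i] :=
  if x is Some _ then fin_chart else inf_chart.

Fact sphere_chart_dom x : chart_dom (sphere_chart x) x.
Proof. by case: x => [w|] //=; exists w. Qed.

Fact sphere_chart_holo x y :
  holomorphic_transition (sphere_chart x) (sphere_chart y).
Proof.
have dV (w : R[i]) : w != 0 -> differentiable (fun z : R[i] => z^-1) w.
  by move=> w0; exact: differentiableV.
case: x => [?|]; case: y => [?|] z; rewrite /sphere_chart /=.
- by [].
- by move=> [w _ <-] /= w0; apply: dV; apply: contra_notN w0 => /eqP ->.
- move=> + [w _ zw]; rewrite -{}zw => /= w0.
  rewrite (_ : _ \o _ = (fun u : R[i] => u^-1)); last first.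
    apply/funext => u /=; rewrite /inf_param; case: eqP => [->|//].
    by rewrite invr0.
  apply: dV; rewrite invr_eq0; apply: contra_notN w0 => /eqP -> //.
- move=> _ _; rewrite (_ : _ \o _ = id) //.
  by apply/funext => u; exact: inf_paramK.
Qed.

Definition riemann_sphere : complexAtlas R[i] :=
  ComplexAtlas sphere_chart_dom sphere_chart_holo.

End RiemannSphere.

Section KobayashiRoyden.
Variables (R : realType) (V : normedModType R[i]) (M : complexAtlas V).

(* An analytic disk is a total map R[i] -> M, of which only the restriction to
   the unit disk matters. *)
Definition analytic_disk (phi : complex_plane R -> M) : Prop :=
  holomorphic_on phi (unit_disk R).

Definition disk_derivative (phi : complex_plane R -> M) (zeta : R[i]) :
  tangent (phi zeta) := differential phi (1 : R[i]).

(* The parameter a = 0 (possible only if phi'(0) = 0) stands for 1/|a| = +oo and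
   does not contribute to the infimum. *)
Definition kobayashi (z : M) (xi : tangent z) : \bar R :=
  ereal_inf [set (cabs a)^-1%:E | a in [set a : R[i] | a != 0 /\
    exists phi : complex_plane R -> M,
      [/\ analytic_disk phi, phi 0 = z & disk_derivative phi 0 = a *: xi]]].

Definition kobayashi_nondegenerate : Prop :=
  forall (z : M) (xi : tangent z), xi != 0 -> (0 < kobayashi xi)%E.

End KobayashiRoyden.

Section NormalAndSemiBloch.
Variable R : realType.

(* [eta] is the component of the tangent vector in the preferred coordinate,
   which is 1/w at the point at infinity. *)
Definition spherical_metric (w : riemann_sphere R) (eta : tangent w) : R :=
  match w with
  | Some u => 2 * cabs eta / (1 + cabs u ^+ 2)
  | None => 2 * cabs eta
  end.

Variables (V : normedModType R[i]) (M : complexAtlas V).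

Definition normal_function (g : M -> riemann_sphere R) : Prop :=
  holomorphic g /\
  exists C : R, forall (z : M) (xi : tangent z),
    ((spherical_metric (differential g xi))%:E <= C%:E * kobayashi xi)%E.

Definition semi_bloch (f : M -> complex_plane R) : Prop :=
  forall lambda : R[i],
    normal_function (fun z => Some (expC (lambda * f z)) : riemann_sphere R).

(* In \bar R, 0^-1 = +oo and 0 * +oo = 0, so the quotient at xi = 0 is 0. *)
Definition sup_derivative (f : M -> complex_plane R) (L : set R[i]) : \bar R :=
  nnsup [set q | exists (z : M) (xi : tangent z), L (f z) /\
    q = ((cabs (differential f xi))%:E / kobayashi xi)%E].

Definition schlicht_disk (f : M -> complex_plane R) (w0 : R[i]) (r : R) : Prop :=
  0 < r /\ exists h : complex_plane R -> M,
    analytic_disk h /\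
    biholomorphic (f \o h : complex_plane R -> complex_plane R)
      (unit_disk R) (disk w0 r).

Definition schlicht_radius (f : M -> complex_plane R) (z : M) : \bar R :=
  nnsup [set r%:E | r in schlicht_disk f (f z)].

Definition sup_schlicht_radius (f : M -> complex_plane R) (L : set R[i]) : \bar R :=
  nnsup [set schlicht_radius f z | z in [set z | L (f z)]].

End NormalAndSemiBloch.

(* Main.v *)
(* Write F = lambda f o phi for an analytic disk phi, and u = Re F.

   (i) => (ii): on a line L choose lambda with Re (lambda w) constant on L; there
   the spherical derivative of exp (lambda f) is a constant multiple of |f_*|.

   (ii) => (iii): a schlicht disk of radius r centred on L lifts to an analytic
   disk on which f is zeta |-> w0 + r zeta, so that |f_*| / k_M >= r at its
   centre.

   (iii) => (i): only the line u = 0 matters. If p is the zero of u nearest to a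
   point z, Harnack's inequality on the disk about z through p gives
   |F'(z)| <= 4 |F'(p)|, while |F'(z)| is O(|u(z)|) when no zero is near; so it
   suffices to bound |F'| on u = 0. If it is large there, a point nearly maximising
   (r - |z|) |F'(z)| on u = 0 has, by the same comparison, a neighbourhood on which
   |F'| is bounded by a multiple of its value at the point, and Landau's theorem
   yields a large schlicht disk centred on u = 0. As 1 + |u| = O(cosh u), the
   bound |F'(0)| = O(1 + |u(0)|) is the normality of exp (lambda f).

   The Schwarz lemma behind all this is obtained from a discrete form of Goursat's
   theorem, with trapezoidal sums in place of integrals. *)
Require Import Defs.
From HB Require Import structures.
From mathcomp Require Import all_boot all_order all_algebra.
From mathcomp Require Import complex.
From mathcomp Require Import all_classical all_reals all_analysis.
From mathcomp Require Import ring lra.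

Set Implicit Arguments.
Unset Strict Implicit.
Unset Printing Implicit Defensive.

Import Order.TTheory GRing.Theory Num.Theory.
Import numFieldNormedType.Exports.
Import ComplexField.Normc.

Local Open Scope classical_set_scope.
Local Open Scope ring_scope.
Local Open Scope complex_scope.

(** * Modulus and real part of complex numbers *)

Section Cabs.
Variable R : realType.
Implicit Types (z w : R[i]) (r x y : R).

Lemma cabs_ge0 z : 0 <= cabs z.
Proof. by rewrite -lecR -cabsE normr_ge0. Qed.

Lemma cabs_gt0 z : (0 < cabs z) = (z != 0).
Proof. by rewrite -ltcR -cabsE normr_gt0. Qed.

Lemma cabs_eq0 z : (cabs z == 0) = (z == 0).
Proof. by rewrite -[RHS]negbK -cabs_gt0 lt0r cabs_ge0 andbT negbK. Qed.

Lemma cabs1 : cabs (1 : R[i]) = 1.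
Proof. by rewrite /= expr0n expr1n addr0 sqrtr1. Qed.

Lemma cabsD z w : cabs (z + w) <= cabs z + cabs w.
Proof. by rewrite -lecR rmorphD -!cabsE ler_normD. Qed.

Lemma cabsB z w : cabs (z - w) <= cabs z + cabs w.
Proof. by rewrite -[leRHS]/(cabs z + _) -(normcN w) cabsD. Qed.

Lemma cabs_distC z w : cabs (z - w) = cabs (w - z).
Proof. by rewrite -normcN opprB. Qed.

Lemma cabs_distD u z w : cabs (z - w) <= cabs (z - u) + cabs (u - w).
Proof. by rewrite -[z - w](subrKA u) cabsD. Qed.

Lemma cabs_leB z w : cabs z - cabs w <= cabs (z - w).
Proof. by rewrite lerBlDr -[in leLHS](subrK w z) cabsD. Qed.

Lemma cabs_real r : cabs r%:C = `|r|.
Proof. by rewrite /= expr0n addr0 sqrtr_sqr. Qed.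

Lemma abs_Re z : `|complex.Re z| <= cabs z.
Proof.
by case: z => x y /=; rewrite -[leLHS]sqrtr_sqr ler_wsqrtr // lerDl sqr_ge0.
Qed.

Lemma abs_Im z : `|complex.Im z| <= cabs z.
Proof.
by case: z => x y /=; rewrite -[leLHS]sqrtr_sqr ler_wsqrtr // lerDr sqr_ge0.
Qed.

Lemma Re_le_cabs z : complex.Re z <= cabs z.
Proof. exact: le_trans (ler_norm _) (abs_Re z). Qed.

Lemma cabs_sqr z : cabs z ^+ 2 = complex.Re z ^+ 2 + complex.Im z ^+ 2.
Proof. by case: z => x y /=; rewrite sqr_sqrtr // addr_ge0 ?sqr_ge0. Qed.

Lemma ReD z w : complex.Re (z + w) = complex.Re z + complex.Re w.
Proof. by case: z w => [? ?] [? ?]. Qed.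

Lemma ReN z : complex.Re (- z) = - complex.Re z.
Proof. by case: z. Qed.

Lemma ReB z w : complex.Re (z - w) = complex.Re z - complex.Re w.
Proof. by rewrite ReD ReN. Qed.

Lemma ReZ r z : complex.Re (r%:C * z) = r * complex.Re z.
Proof. by case: z => ? ? /=; rewrite mul0r subr0. Qed.

Lemma Re_mul z w : complex.Re (z * w) =
  complex.Re z * complex.Re w - complex.Im z * complex.Im w.
Proof. by case: z w => [? ?] [? ?]. Qed.

End Cabs.

(** * Calculus of the complex derivative *)

Section ComplexDerivative.
Variable R : realType.
Implicit Types (F G : R[i] -> R[i]) (z w a b : R[i]).

Lemma continuous_atP F z : {for z, continuous F} <->
  forall e : R, 0 < e -> exists2 d : R, 0 < d &
    forall w, cabs (w - z) < d -> cabs (F w - F z) < e.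
Proof.
split.
- move=> cF e e0; have := cF (disk (F z) e).
  have hn : nbhs (F z) (disk (F z) e) by apply/nbhs_diskP; exists e.
  by move=> /(_ hn)/nbhs_diskP[d d0 h]; exists d => // w /h.
- move=> h A /nbhs_diskP[e e0 sA]; have [d d0 hd] := h e e0.
  by apply/nbhs_diskP; exists d => // w /hd hw; exact: sA.
Qed.

(* Caratheodory's form of the derivative: the difference quotient extends
   continuously to z. *)
Definition has_deriv F z a :=
  exists Q, [/\ forall w, F w = F z + (w - z) * Q w, {for z, continuous Q}
    & Q z = a].

Lemma has_derivP F z a : has_deriv F z a <->
  forall e : R, 0 < e -> exists2 d : R, 0 < d & forall w, cabs (w - z) < d ->
    cabs (F w - F z - (w - z) * a) <= e * cabs (w - z).
Proof.
split.
- move=> [Q [FQ /continuous_atP cQ Qa]] e e0; have [d d0 hd] := cQ e e0.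
  exists d => // w /hd /ltW; rewrite FQ [F z + _]addrC addrK -mulrBr normcM mulrC Qa => h.
  by rewrite ler_wpM2r ?cabs_ge0.
- move=> h; exists (fun w => if w == z then a else (F w - F z) / (w - z)).
  split; last by rewrite eqxx.
  + move=> w; case: eqVneq => [->|wz]; first by rewrite subrr mul0r addr0.
    by rewrite mulrC divfK ?subr_eq0 // addrC subrK.
  + apply/continuous_atP => e e0; have [|d d0 hd] := h (e / 2).
      by rewrite divr_gt0.
    exists d => // w /hd; rewrite eqxx.
    case: eqVneq => [->|wz]; first by move=> _; rewrite subrr normc0.
    rewrite -subr_eq0 in wz.
    rewrite -(ler_pdivrMr _ _ _) ?cabs_gt0 // -normcV -normcM mulrBl.
    rewrite [(w - z) * a]mulrC mulfK // => /le_lt_trans; apply.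
    by rewrite ltr_pdivrMr // ltr_pMr // ltr1n.
Qed.

Lemma has_deriv_continuous F z a : has_deriv F z a -> {for z, continuous F}.
Proof.
move=> [Q [FQ cQ _]]; rewrite (_ : F = fun w => F z + (w - z) * Q w); last first.
  by apply/funext.
have cB : {for z, continuous (fun w => w - z)}.
  exact: (cvgB (@cvg_id _ _) (@cvg_cst _ _ _ _ _)).
exact: (cvgD (@cvg_cst _ _ _ _ _) (cvgM cB cQ)).
Qed.

Lemma has_deriv_near F G z a : (\forall w \near z, F w = G w) ->
  has_deriv F z a -> has_deriv G z a.
Proof.
move=> /nbhs_diskP[r r0 hr] /has_derivP h; apply/has_derivP => e /h[d d0 hd].
exists (Order.min d r); first by rewrite lt_min d0.
move=> w; rewrite lt_min => /andP[wd wr]; rewrite -hr // -hr ?hd //.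
by rewrite /disk /mkset subrr normc0.
Qed.

Lemma has_deriv_disk F G z r a : 0 < r -> (forall w, disk z r w -> F w = G w) ->
  has_deriv F z a -> has_deriv G z a.
Proof. by move=> r0 h; apply: has_deriv_near; apply/nbhs_diskP; exists r. Qed.

Lemma has_deriv_cst b z : has_deriv (fun=> b) z 0.
Proof.
exists (fun=> 0); split; first by move=> w; rewrite mulr0 addr0.
  exact: cst_continuous.
by [].
Qed.

Lemma has_deriv_id z : has_deriv id z 1.
Proof.
exists (fun=> 1); split; first by move=> w; rewrite mulr1 addrC subrK.
  exact: cst_continuous.
by [].
Qed.

Lemma has_derivD F G z a b : has_deriv F z a -> has_deriv G z b ->
  has_deriv (fun w => F w + G w) z (a + b).
Proof.
move=> [P [FP cP <-]] [Q [GQ cQ <-]]; exists (fun w => P w + Q w); split.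
- by move=> w; rewrite FP GQ; ring.
- exact: (cvgD cP cQ).
- by [].
Qed.

Lemma has_derivM F G z a b : has_deriv F z a -> has_deriv G z b ->
  has_deriv (fun w => F w * G w) z (a * G z + F z * b).
Proof.
move=> dF dG; have cG := has_deriv_continuous dG.
move: dF dG => [P [FP cP <-]] [Q [GQ cQ <-]].
exists (fun w => P w * G w + F z * Q w); split.
- move=> w; transitivity (F z * (G z + (w - z) * Q w) + (w - z) * P w * G w).
    by rewrite -GQ FP mulrDl.
  by ring.
- exact: (cvgD (cvgM cP cG) (cvgM (@cvg_cst _ _ _ _ _) cQ)).
- by [].
Qed.

Lemma has_derivZ F z a b : has_deriv F z a ->
  has_deriv (fun w => b * F w) z (b * a).
Proof.
by move=> dF; have := has_derivM (has_deriv_cst b z) dF; rewrite mul0r add0r.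
Qed.

Lemma has_derivN F z a : has_deriv F z a -> has_deriv (fun w => - F w) z (- a).
Proof.
move=> /(has_derivZ (-1)); rewrite mulN1r.
by congr has_deriv; apply/funext => w; rewrite mulN1r.
Qed.

Lemma has_derivB F G z a b : has_deriv F z a -> has_deriv G z b ->
  has_deriv (fun w => F w - G w) z (a - b).
Proof. by move=> dF /has_derivN; exact: has_derivD. Qed.

Lemma has_deriv_comp F G z a b : has_deriv G z b -> has_deriv F (G z) a ->
  has_deriv (F \o G) z (a * b).
Proof.
move=> dG; have cG := has_deriv_continuous dG.
move: dG => [Q [GQ cQ <-]] [P [FP cP <-]].
exists (fun w => P (G w) * Q w); split.
- by move=> w; rewrite /= [LHS]FP (_ : G w - G z = (w - z) * Q w) ?(GQ w); ring.
- exact: (cvgM (continuous_comp cG cP) cQ).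
- by [].
Qed.

Lemma has_derivV z : z != 0 -> has_deriv (fun w => w^-1) z (- z^-2).
Proof.
(* Redefining the inverse at 0 as [z^-1 + z^-1] makes the factorisation with quotient [- z^-2] hold
   at [w = 0] as well. *)
move=> z0; apply: (@has_deriv_near (fun w => if w == 0 then z^-1 + z^-1 else w^-1)).
  by apply: filterS (near_neq0 z0) => w /negPf ->.
exists (fun w => if w == 0 then - z^-2 else - (z * w)^-1); split.
- by move=> w; rewrite (negPf z0); case: eqVneq => [->|w0]; field; rewrite ?z0 ?w0.
- have nz : \forall w \near z, - (z * w)^-1 = if w == 0 then - z ^- 2 else - (z * w)^-1.
    by apply: filterS (near_neq0 z0) => w /negPf ->.
  rewrite /continuous_at /prop_for /= (negPf z0).
  apply: (cvg_trans (near_eq_cvg nz)); apply: cvgN.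
  apply: cvgV; first by rewrite mulf_neq0.
  exact: has_deriv_continuous (has_derivZ z (has_deriv_id z)).
- by rewrite (negPf z0) -expr2.
Qed.

Lemma has_deriv_inv F z a : F z != 0 -> has_deriv F z a ->
  has_deriv (fun w => (F w)^-1) z (- a / F z ^+ 2).
Proof.
move=> Fz0 dF; have := has_deriv_comp dF (has_derivV Fz0).
by rewrite mulNr mulrC -mulNr.
Qed.

Lemma has_deriv_unique F z a b : has_deriv F z a -> has_deriv F z b -> a = b.
Proof.
move=> /has_derivP da /has_derivP db; apply/eqP; rewrite -subr_eq0.
rewrite -cabs_eq0; apply/eqP/le_anti; rewrite cabs_ge0 andbT.
apply/ler_addgt0Pr => e e0; rewrite add0r.
have e20 : 0 < e / 2 by rewrite divr_gt0.
have [d d0 hd] := da _ e20; have [d' d'0 hd'] := db _ e20.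
pose t := Order.min d d' / 2.
have t0 : 0 < t by rewrite divr_gt0 // lt_min d0.
have tm : t < Order.min d d' by rewrite ltr_pdivrMr ?ltr_pMr ?ltr1n // lt_min d0.
move: tm; rewrite lt_min => /andP[td td'].
have ct : cabs ((z + t%:C) - z) = t by rewrite addrC addKr cabs_real gtr0_norm.
have := hd (z + t%:C); rewrite ct => /(_ td) h1.
have := hd' (z + t%:C); rewrite ct => /(_ td') h2.
have h3 := le_trans (cabsB _ _) (lerD h2 h1).
rewrite -(ler_pM2l t0); apply: le_trans (le_trans _ h3) _; last by lra.
rewrite -[X in X * _]ct -normcM; rewrite le_eqVlt; apply/orP; left; apply/eqP; congr cabs.
by ring.
Qed.

End ComplexDerivative.

(** * The complex exponential and its derivative *)

Section ComplexExponential.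
Variable R : realType.
Implicit Types (z w : R[i]) (x y e : R).

Lemma is_derive_expansion (f : R -> R) x a : is_derive x 1 f a ->
  forall e, 0 < e -> exists2 d : R, 0 < d &
    forall h, `|h| < d -> `|f (x + h) - f x - h * a| <= e * `|h|.
Proof.
move=> [df <-] e e0; have := df; rewrite /derivable => /cvg_ex[l hl].
have -> : 'D_1 f x = l by apply: cvg_lim hl.
have /cvgrPdist_le/(_ e e0) := hl.
move=> /nbhs_ballP[d d0 hd]; exists d => // h hd'.
have [->|h0] := eqVneq h 0.
  by rewrite addr0 subrr mul0r subr0 normr0 mulr0.
have := hd h; rewrite /ball /= sub0r normrN => /(_ hd' h0).
rewrite -(ler_pM2r (_ : 0 < `|h|)) ?normr_gt0 // -normrM distrC.
rewrite /GRing.scale /= mulr1 mulrBl mulrAC mulVf // mul1r addrC [h + x]addrC.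
by rewrite [h * l]mulrC [- _ + _]addrC.
Qed.

Lemma cabs_le_ReIm z : cabs z <= `|complex.Re z| + `|complex.Im z|.
Proof.
case: z => x y; have {1}-> : x +i* y = x%:C + 'i * y%:C by simpc.
apply: le_trans (cabsD _ _) _; rewrite normcM !cabs_real.
have -> : cabs ('i : R[i]) = 1 by rewrite /= expr0n expr1n add0r sqrtr1.
by rewrite mul1r.
Qed.

Lemma expC0 : expC (0 : R[i]) = 1.
Proof. by rewrite /expC /= expR0 cos0 sin0 mul1r. Qed.

Lemma expCD z w : expC (z + w) = expC z * expC w.
Proof.
case: z w => [x y] [x' y']; rewrite /expC /= expRD cosD sinD.
by apply/eqP; rewrite eq_complex /=; apply/andP; split; apply/eqP; ring.
Qed.

Lemma cabs_expC z : cabs (expC z) = expR (complex.Re z).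
Proof.
rewrite /expC normcM cabs_real gtr0_norm ?expR_gt0 //=.
by rewrite cos2Dsin2 sqrtr1 mulr1.
Qed.

Lemma expC_neq0 z : expC z != 0.
Proof. by rewrite -cabs_gt0 cabs_expC expR_gt0. Qed.

Lemma expC_2pi z : expC (z + 0 +i* (2 * pi)) = expC z.
Proof.
rewrite expCD; suff -> : expC (0 +i* (2 * pi) : R[i]) = 1 by rewrite mulr1.
by rewrite /expC /= expR0 mul1r !mulr_natl cos2pi sin2pi.
Qed.

Lemma has_deriv_expC0 : has_deriv (@expC R) 0 1.
Proof.
apply/has_derivP => e0 e00; rewrite expC0.
(* With [t] the modulus of the increment, the real part of the remainder is at most [4 e t] and the
   imaginary part at most [5 e t], whence the 9; [e <= 1] absorbs products of small terms. *)
have [e [e_gt0 e1 e9]] : exists e, [/\ 0 < e, e <= 1 & e <= e0 / 9].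
  exists (Order.min (e0 / 9) 1).
  by rewrite lt_min ltr01 andbT divr_gt0 // !ge_min !lexx orbT.
have [d1 d10 h1] := is_derive_expansion (is_derive_expR 0) e_gt0.
have [d2 d20 h2] := is_derive_expansion (is_derive_cos 0) e_gt0.
have [d3 d30 h3] := is_derive_expansion (is_derive_sin 0) e_gt0.
exists (Order.min (Order.min d1 d2) (Order.min d3 e)).
  by rewrite !lt_min d10 d20 d30 e_gt0.
move=> [x y]; rewrite subr0 !lt_min => /andP[/andP[t1 t2] /andP[t3 te]].
have := abs_Im (x +i* y); have := abs_Re (x +i* y).
have := cabs_ge0 (x +i* y).
move: (cabs _ : R) t1 t2 t3 te => t t1 t2 t3 te t0 xt yt.
change (is_true (`|x| <= t)) in xt; change (is_true (`|y| <= t)) in yt.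
have {h1} := h1 _ (le_lt_trans xt t1).
have {h2} := h2 _ (le_lt_trans yt t2).
have {h3} := h3 _ (le_lt_trans yt t3).
rewrite !add0r expR0 cos0 sin0 oppr0 mulr0 !subr0 ?addr0 !mulr1.
set r3 := sin y - y; set r2 := cos y - 1; set r1 := expR x - 1 - x.
have {}yt2 : e * `|y| <= e * t by rewrite ler_wpM2l // ltW.
have {}xt2 : e * `|x| <= e * t by rewrite ler_wpM2l // ltW.
move=> /le_trans-/(_ _ yt2) h3 /le_trans-/(_ _ yt2) h2 /le_trans-/(_ _ xt2) h1.
have -> : expC (x +i* y) - 1 - (x +i* y) =
    (x * r2 + r1 + r2 + r1 * r2) +i* (r3 + (x + r1) * (y + r3)).
  rewrite /expC /r1 /r2 /r3 /=; apply/eqP; rewrite eq_complex /=.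
  by apply/andP; split; apply/eqP; ring.
apply: le_trans (cabs_le_ReIm _) _; rewrite /=.
have b1 : `|x * r2 + r1 + r2 + r1 * r2| <= 4 * (e * t).
  have p1 : `|x * r2| <= 1 * (e * t).
    by rewrite normrM ler_pM // (le_trans xt) // ltW // (lt_le_trans te).
  have p2 : `|r1 * r2| <= 1 * (e * t).
    rewrite normrM ler_pM // (le_trans h1) // -[leRHS]mulr1 ler_pM //; first exact: ltW.
    by rewrite ltW // (lt_le_trans te).
  have := ler_normD (x * r2 + r1 + r2) (r1 * r2).
  have := ler_normD (x * r2 + r1) r2; have := ler_normD (x * r2) r1; lra.
have b2 : `|r3 + (x + r1) * (y + r3)| <= 5 * (e * t).
  have q1 : `|x + r1| <= 2 * e.
    apply: (le_trans (ler_normD _ _)); have : e * t <= e * 1.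
      by rewrite ler_wpM2l ?ltW // (lt_le_trans te).
    by move: te => /ltW; lra.
  have q2 : `|y + r3| <= 2 * t.
    apply: (le_trans (ler_normD _ _)); have : e * t <= 1 * t.
      exact: ler_wpM2r.
    by lra.
  have : `|(x + r1) * (y + r3)| <= 2 * e * (2 * t) by rewrite normrM ler_pM.
  by have := ler_normD r3 ((x + r1) * (y + r3)); lra.
have : e * t <= e0 / 9 * t by rewrite ler_wpM2r.
by lra.
Qed.

(** The addition formula carries the derivative at 0 to every point. *)
Lemma has_deriv_expC z : has_deriv (@expC R) z (expC z).
Proof.
have d1 : has_deriv (fun w => w - z) z (1 - 0).
  exact: has_derivB (has_deriv_id z) (has_deriv_cst z z).
have d2 : has_deriv (@expC R) (z - z) 1 by rewrite subrr; exact: has_deriv_expC0.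
have := has_derivZ (expC z) (has_deriv_comp d1 d2).
rewrite subr0 !mulr1; congr has_deriv; apply/funext => w /=.
by rewrite -expCD addrC subrK.
Qed.

End ComplexExponential.

(** * Proof by repeated bisection of a square *)

Section Bisection.
Variable R : realType.
Implicit Types (a b h d : R).

(** Left ends increase and right ends decrease, so these are nested intervals and the supremum of
    the left ends lies in all of them. *)
Lemma halving_limit (u : nat -> R) : u 0%N = 0 ->
  (forall k, u k <= u k.+1 <= u k + 2^-1 ^+ k.+1) ->
  (forall k, 0 <= u k /\ u k + 2^-1 ^+ k <= 1) /\
  exists l, forall k, u k <= l <= u k + 2^-1 ^+ k.
Proof.
move=> u0 hu.
have inc j k : (j <= k)%N -> u j <= u k.
  move=> /subnK <-; elim: (k - j)%N => // n ih; rewrite addSn.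
  by apply: le_trans ih _; have /andP[] := hu (n + j)%N.
have dec j k : (j <= k)%N -> u k + 2^-1 ^+ k <= u j + 2^-1 ^+ j.
  move=> /subnK <-; elim: (k - j)%N => // n ih; rewrite addSn.
  apply: le_trans ih; have /andP[_] := hu (n + j)%N.
  by rewrite (exprS _ (n + j)); lra.
have p0 k : 0 <= (2^-1 : R) ^+ k by rewrite exprn_ge0.
have cross j k : u j <= u k + 2^-1 ^+ k.
  case: (leqP j k) => [/inc h|/ltnW /dec].
    by rewrite (le_trans h) // lerDl.
  by apply: le_trans; rewrite lerDl.
split.
  move=> k; split; first by rewrite -u0 inc.
  by have := dec 0%N k (leq0n k); rewrite u0 expr0 add0r.
have hs : has_sup (range u).
  by split; [exists (u 0%N), 0%N|exists (u 0%N + 2^-1 ^+ 0) => _ [j _ <-]].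
exists (sup (range u)) => k; apply/andP; split.
  by apply: sup_upper_bound => //; exists k.
by apply: sup_le_ub; [exists (u 0%N), 0%N|move=> _ [j _ <-]].
Qed.

(** [P a b h] is read as a claim on the square of side [h] with corner [(a, b)]. If it failed on the
    unit square, it would fail on some quarter, and so on; the failing squares shrink to a point
    [(a0, b0)], against the local hypothesis there. Both Goursat's theorem and the mean value
    inequality below rest on it. *)
Lemma bisection (P : R -> R -> R -> Prop) :
  (forall a b h, 0 < h -> P a b (h / 2) -> P (a + h / 2) b (h / 2) ->
    P a (b + h / 2) (h / 2) -> P (a + h / 2) (b + h / 2) (h / 2) -> P a b h) ->
  (forall a0 b0, 0 <= a0 <= 1 -> 0 <= b0 <= 1 -> exists2 d : R, 0 < d &
    forall a b h, 0 < h < d -> a <= a0 <= a + h -> b <= b0 <= b + h ->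
    0 <= a -> a + h <= 1 -> 0 <= b -> b + h <= 1 -> P a b h) ->
  P 0 0 1.
Proof.
move=> step loc; apply: contrapT => nP.
have half_gt0 k : 0 < (2^-1 : R) ^+ k by rewrite exprn_gt0.
have /choice[child hc] : forall s : nat * (R * R), exists t : R * R,
    ~ P s.2.1 s.2.2 (2^-1 ^+ s.1) ->
    [/\ ~ P t.1 t.2 (2^-1 ^+ s.1.+1),
      s.2.1 <= t.1 <= s.2.1 + 2^-1 ^+ s.1.+1 &
      s.2.2 <= t.2 <= s.2.2 + 2^-1 ^+ s.1.+1].
  move=> [n [a b]] /=; set h := 2^-1 ^+ n.
  have -> : (2^-1 : R) ^+ n.+1 = h / 2 by rewrite exprSr.
  have h20 : 0 <= h / 2 by rewrite divr_ge0 // ltW // half_gt0.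
  apply: contrapT => /forallNP nt; apply: (nt (a, b)) => /= bad.
  exfalso; apply: bad; apply: step; first exact: half_gt0.
  - apply: contrapT => bad.
    by apply: (nt (a, b)) => _ /=; split; rewrite ?lexx ?lerDl.
  - apply: contrapT => bad.
    by apply: (nt (a + h / 2, b)) => _ /=; split; rewrite ?lexx ?lerDl ?h20.
  - apply: contrapT => bad.
    by apply: (nt (a, b + h / 2)) => _ /=; split; rewrite ?lexx ?lerDl ?h20.
  - apply: contrapT => bad.
    by apply: (nt (a + h / 2, b + h / 2)) => _ /=; split; rewrite ?lexx ?lerDl ?h20.
pose s := fix s n := if n is m.+1 then child (m, s m) else (0, 0).
have bad n : ~ P (s n).1 (s n).2 (2^-1 ^+ n).
  by elim: n => [|n ih]; [rewrite expr0|have [] := hc (n, s n) ih].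
have [|ba [a0 ha0]] := @halving_limit (fun n => (s n).1) erefl.
  by move=> k; have [] := hc (k, s k) (bad k).
have [|bb [b0 hb0]] := @halving_limit (fun n => (s n).2) erefl.
  by move=> k; have [] := hc (k, s k) (bad k).
have [||d d0 hd] := loc a0 b0.
- by have := ha0 0%N; rewrite add0r.
- by have := hb0 0%N; rewrite add0r.
(* This exponent satisfies [d^-1 < 2 ^ k], so the failing square of side [2^-1 ^ k] falls under the
   local hypothesis. *)
pose k := Num.bound d^-1.
apply: (bad k); apply: hd => //.
- rewrite half_gt0 /= exprVn -[ltRHS]invrK ltf_pV2 ?posrE ?invr_gt0 ?exprn_gt0 //.
  exact: upper_nthrootP.
- by have [] := ba k.
- by have [] := ba k.
- by have [] := bb k.
- by have [] := bb k.
Qed.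

End Bisection.

(** * Trapezoidal contour sums and Goursat's theorem *)

Section Goursat.
Variable R : realType.
Implicit Types (g : R[i] -> R[i]) (p q s t z w a b : R[i]) (N : nat).

(* Trapezoidal average of g over 2^N equal pieces of the segment [p, q]. The
   recursion makes the sums exactly additive under bisection and exact on affine
   functions, which is all that Goursat's argument asks of an integral. *)
Fixpoint seg_avg N g p q : R[i] :=
  if N is n.+1 then
    let m := (p + q) / 2 in (seg_avg n g p m + seg_avg n g m q) / 2
  else (g p + g q) / 2.

Definition seg_int N g p q := (q - p) * seg_avg N g p q.

Lemma seg_avgC N g p q : seg_avg N g p q = seg_avg N g q p.
Proof.
elim: N p q => [|N ih] p q /=; first by rewrite addrC.
by rewrite (ih p) (ih _ q) addrC [q + p]addrC.
Qed.

Lemma seg_intN N g p q : seg_int N g q p = - seg_int N g p q.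
Proof. by rewrite /seg_int seg_avgC -mulNr opprB. Qed.

Lemma seg_int_split N g p q : seg_int N.+1 g p q =
  seg_int N g p ((p + q) / 2) + seg_int N g ((p + q) / 2) q.
Proof. by rewrite /seg_int /=; field. Qed.

Lemma seg_avg_affine N a b p q :
  seg_avg N (fun w => a + w * b) p q = a + (p + q) / 2 * b.
Proof.
by elim: N p q => [|N ih] p q /=; [|rewrite !ih]; field.
Qed.

Lemma seg_avgB N f g p q :
  seg_avg N (fun w => f w - g w) p q = seg_avg N f p q - seg_avg N g p q.
Proof.
by elim: N p q => [|N ih] p q /=; [|rewrite !ih]; field.
Qed.

Lemma seg_avg_shift N g p q t : (forall w, g (w + t) = g w) ->
  seg_avg N g (p + t) (q + t) = seg_avg N g p q.
Proof.
move=> gt; elim: N p q => [|N ih] p q /=; first by rewrite !gt.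
have -> : (p + t + (q + t)) / 2 = (p + q) / 2 + t by field.
by rewrite !ih.
Qed.

Definition midpoint_convex (C : R[i] -> Prop) :=
  forall z w, C z -> C w -> C ((z + w) / 2).

(** Sample points and averages are built by midpoints only, so midpoint convexity suffices; this
    confines averages to disks and half-planes. *)
Lemma seg_avg_convex N g (C D : R[i] -> Prop) p q :
  midpoint_convex C -> midpoint_convex D -> (forall w, C w -> D (g w)) ->
  C p -> C q -> D (seg_avg N g p q).
Proof.
move=> mC mD CD; elim: N p q => [|N ih] p q Cp Cq /=.
  by apply: mD; exact: CD.
by apply: mD; apply: ih => //; exact: mC.
Qed.

Lemma cabs2 : cabs (2 : R[i]) = 2.
Proof.
have -> : (2 : R[i]) = 2%:C by rewrite rmorphD.
by rewrite cabs_real ger0_norm.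
Qed.

Lemma midpoint_convex_disk c (r : R) :
  midpoint_convex (fun w => cabs (w - c) <= r).
Proof.
move=> z w hz hw; have -> : (z + w) / 2 - c = (z - c + (w - c)) / 2 by field.
rewrite normcM normcV cabs2 ler_pdivrMr // mulr_natr mulr2n.
by apply: le_trans (cabsD _ _) _; rewrite lerD.
Qed.

Lemma Re_midpoint z w :
  complex.Re ((z + w) / 2) = (complex.Re z + complex.Re w) / 2.
Proof.
have -> : (z + w) / 2 = 2^-1%:C * (z + w).
  by rewrite fmorphV rmorphD /= mulrC.
by rewrite ReZ ReD mulrC.
Qed.

Lemma midpoint_convex_Re_eq (b : R) :
  midpoint_convex (fun w => complex.Re w = b).
Proof. by move=> z w hz hw; rewrite Re_midpoint hz hw; field. Qed.

Lemma midpoint_convex_Re_le (b : R) :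
  midpoint_convex (fun w => complex.Re w <= b).
Proof. by move=> z w hz hw; rewrite Re_midpoint; lra. Qed.

Lemma midpoint_convex_Re_ge (b : R) :
  midpoint_convex (fun w => b <= complex.Re w).
Proof. by move=> z w hz hw; rewrite Re_midpoint; lra. Qed.

(** The counterpart of the contour integral around the parallelogram with corner [p] and sides [s]
    and [t]. *)
Definition par_int N g p s t :=
  seg_int N g p (p + s) + seg_int N g (p + s) (p + s + t)
  + seg_int N g (p + s + t) (p + t) + seg_int N g (p + t) p.

(** Each inner side is traversed twice in opposite directions and cancels. One level of refinement
    is spent on the cut. *)
Lemma par_int_split N g p s t : par_int N.+1 g p s t =
  par_int N g p (s / 2) (t / 2) + par_int N g (p + s / 2) (s / 2) (t / 2)
  + par_int N g (p + t / 2) (s / 2) (t / 2)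
  + par_int N g (p + s / 2 + t / 2) (s / 2) (t / 2).
Proof.
rewrite /par_int !seg_int_split.
have -> : (p + (p + s)) / 2 = p + s / 2 by field.
have -> : (p + s + (p + s + t)) / 2 = p + s + t / 2 by field.
have -> : (p + s + t + (p + t)) / 2 = p + s / 2 + t by field.
have -> : (p + t + p) / 2 = p + t / 2 by field.
have -> : p + s / 2 + s / 2 = p + s by field.
have -> : p + t / 2 + s / 2 = p + s / 2 + t / 2 by field.
have -> : p + s / 2 + t / 2 + s / 2 = p + s + t / 2 by field.
have -> : p + s / 2 + t / 2 + t / 2 = p + s / 2 + t by field.
have -> : p + t / 2 + t / 2 = p + t by field.
have -> : p + s + t / 2 + t / 2 = p + s + t by field.
rewrite (seg_intN N g (p + s / 2) (p + s / 2 + t / 2)).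
rewrite (seg_intN N g (p + t / 2) (p + s / 2 + t / 2)).
rewrite (seg_intN N g (p + s / 2 + t / 2) (p + s / 2 + t)).
rewrite (seg_intN N g (p + s / 2 + t / 2) (p + s + t / 2)).
by ring.
Qed.

(** On each side the sum is exactly the increment of the primitive [a w + b w^2 / 2], and increments
    cancel around a closed contour. *)
Lemma par_int_affine N a b p s t : par_int N (fun w => a + w * b) p s t = 0.
Proof. by rewrite /par_int /seg_int !seg_avg_affine; field. Qed.

Lemma par_intB N f g p s t : par_int N (fun w => f w - g w) p s t =
  par_int N f p s t - par_int N g p s t.
Proof. by rewrite /par_int /seg_int !seg_avgB; ring. Qed.

Lemma par_int_bound N g p s t c (r k : R) :
  (forall w, cabs (w - c) <= r -> cabs (g w) <= k) ->
  cabs (p - c) <= r -> cabs (p + s - c) <= r -> cabs (p + t - c) <= r ->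
  cabs (p + s + t - c) <= r ->
  cabs (par_int N g p s t) <= 2 * (cabs s + cabs t) * k.
Proof.
move=> hg hp hs ht hst.
have b x y : cabs (x - c) <= r -> cabs (y - c) <= r ->
    cabs (seg_int N g x y) <= cabs (y - x) * k.
  move=> hx hy; rewrite normcM ler_wpM2l ?cabs_ge0 //.
  have mk : midpoint_convex (fun w => cabs w <= k).
    by move=> z w hz hw; have := @midpoint_convex_disk 0 k z w; rewrite !subr0; apply.
  exact: (seg_avg_convex N (midpoint_convex_disk (c := c) (r := r)) mk).
have {hp hs ht hst} := (b _ _ hp hs, b _ _ hs hst, b _ _ hst ht, b _ _ ht hp).
have -> : p + s - p = s by ring.
have -> : p + s + t - (p + s) = t by ring.
have -> : p + t - (p + s + t) = - s by ring.
have -> : p - (p + t) = - t by ring.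
rewrite !normcN => -[[[h1 h2] h3] h4].
have := cabsD (seg_int N g p (p + s) + seg_int N g (p + s) (p + s + t)
  + seg_int N g (p + s + t) (p + t)) (seg_int N g (p + t) p).
have := cabsD (seg_int N g p (p + s) + seg_int N g (p + s) (p + s + t))
  (seg_int N g (p + s + t) (p + t)).
have := cabsD (seg_int N g p (p + s)) (seg_int N g (p + s) (p + s + t)).
rewrite /par_int; lra.
Qed.

(** The bound [e h^2] on parallelograms scaled by [h] is additive over the four quarters. Near a
    point of differentiability the affine part contributes 0, and the rest is [o(h)] over a
    perimeter of order [h]. Trapezoidal sums only tend to 0, hence the threshold on [N]. *)
Lemma goursat g p s t :
  (forall a b : R, 0 <= a <= 1 -> 0 <= b <= 1 ->
    exists d, has_deriv g (p + a%:C * s + b%:C * t) d) ->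
  forall e : R, 0 < e ->
    exists N0, forall N, (N0 <= N)%N -> cabs (par_int N g p s t) <= e.
Proof.
move=> dg e e0.
pose good (a b h : R) := exists N0, forall N, (N0 <= N)%N ->
    cabs (par_int N g (p + a%:C * s + b%:C * t) (h%:C * s) (h%:C * t))
      <= e * h ^+ 2.
suff : good 0 0 1 by rewrite /good !mul0r !mul1r !addr0 expr1n mulr1.
apply: (@bisection R good) => [a b h h0 [N1 H1] [N2 H2] [N3 H3] [N4 H4]|a0 b0 ha0 hb0].
  (* The successor pays for the level of refinement lost in the splitting. *)
  exists (maxn (maxn N1 N2) (maxn N3 N4)).+1 => -[//|N].
  rewrite ltnS !geq_max => /andP[/andP[/H1 h1 /H2 h2] /andP[/H3 h3 /H4 h4]].
  have hs x : (h / 2)%:C * x = h%:C * x / 2.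
    by rewrite rmorphM fmorphV rmorphD /= mulrAC.
  rewrite par_int_split -!hs.
  rewrite !rmorphD /= !(mulrDl _ _ s) !(mulrDl _ _ t) in h1 h2 h3 h4.
  set P := p + a%:C * s + b%:C * t.
  have -> : P + (h / 2)%:C * s = p + (a%:C * s + (h / 2)%:C * s) + b%:C * t.
    by rewrite /P; ring.
  have -> : P + (h / 2)%:C * t = p + a%:C * s + (b%:C * t + (h / 2)%:C * t).
    by rewrite /P; ring.
  have -> : p + (a%:C * s + (h / 2)%:C * s) + b%:C * t + (h / 2)%:C * t
    = p + (a%:C * s + (h / 2)%:C * s) + (b%:C * t + (h / 2)%:C * t) by ring.
  apply: le_trans (cabsD _ _) _; apply: le_trans (lerD (cabsD _ _) h4) _.
  apply: le_trans (lerD (lerD (cabsD _ _) h3) (lexx _)) _.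
  apply: le_trans (lerD (lerD (lerD h1 h2) (lexx _)) (lexx _)) _.
  by rewrite le_eqVlt; apply/orP; left; apply/eqP; field.
have [A /has_derivP dA] := dg a0 b0 ha0 hb0.
set z0 := p + a0%:C * s + b0%:C * t in dA.
set l := cabs s + cabs t.
have l0 : 0 <= l by rewrite addr_ge0 ?cabs_ge0.
(* With this slope the remainder is at most [e h l / (2 (l^2 + 1))] on a perimeter [2 h l], which
   gives at most [e h^2]; the [+ 1] guards against [l = 0]. *)
have [|d d0 hd] := dA (e / (2 * (l ^+ 2 + 1))).
  by rewrite divr_gt0 // mulr_gt0 // ltr_wpDl ?sqr_ge0.
exists (d / (l + 1)); first by rewrite divr_gt0 // ltr_wpDl.
move=> a b h /andP[h0 hdl] /andP[aa0 aa1] /andP[bb0 bb1] _ _ _ _.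
exists 0%N => N _; set P := p + a%:C * s + b%:C * t.
have hl : h * l < d.
  apply: le_lt_trans (_ : h * (l + 1) < d); last by rewrite -ltr_pdivlMr // ltr_wpDl.
  by rewrite ler_wpM2l ?lerDl // ltW.
have corner (x y : R) : `|x| <= h -> `|y| <= h ->
    cabs (x%:C * s + y%:C * t) <= h * l.
  move=> hx hy; apply: le_trans (cabsD _ _) _; rewrite !normcM !cabs_real mulrDr.
  by rewrite lerD // ler_wpM2r ?cabs_ge0.
pose rho w := g w - (fun w => (g z0 - z0 * A) + w * A) w.
have -> : par_int N g P (h%:C * s) (h%:C * t) =
    par_int N rho P (h%:C * s) (h%:C * t).
  by rewrite /rho par_intB par_int_affine subr0.
have rhoE w : cabs (w - z0) <= h * l ->
    cabs (rho w) <= e / (2 * (l ^+ 2 + 1)) * (h * l).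
  move=> hw; have -> : rho w = g w - g z0 - (w - z0) * A by rewrite /rho; ring.
  apply: le_trans (hd _ (le_lt_trans hw hl)) _; rewrite ler_wpM2l //.
  by rewrite ltW // divr_gt0 // mulr_gt0 // ltr_wpDl ?sqr_ge0.
apply: (@le_trans _ _ (2 * (h * l) * (e / (2 * (l ^+ 2 + 1)) * (h * l)))).
  have El : cabs (h%:C * s) + cabs (h%:C * t) = h * l.
    by rewrite !normcM !cabs_real gtr0_norm // mulrDr.
  rewrite -[X in 2 * X * _]El.
  apply: (par_int_bound _ rhoE).
  - have -> : P - z0 = (a - a0)%:C * s + (b - b0)%:C * t.
      by rewrite /P /z0 !rmorphB /=; ring.
    by apply: corner; rewrite ler_norml; lra.
  - have -> : P + h%:C * s - z0 = (a + h - a0)%:C * s + (b - b0)%:C * t.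
      by rewrite /P /z0 !rmorphB !rmorphD /=; ring.
    by apply: corner; rewrite ler_norml; lra.
  - have -> : P + h%:C * t - z0 = (a - a0)%:C * s + (b + h - b0)%:C * t.
      by rewrite /P /z0 !rmorphB !rmorphD /=; ring.
    by apply: corner; rewrite ler_norml; lra.
  - have -> : P + h%:C * s + h%:C * t - z0 = (a + h - a0)%:C * s + (b + h - b0)%:C * t.
      by rewrite /P /z0 !rmorphB !rmorphD /=; ring.
    by apply: corner; rewrite ler_norml; lra.
have -> : 2 * (h * l) * (e / (2 * (l ^+ 2 + 1)) * (h * l)) =
    e * h ^+ 2 * (l ^+ 2 / (l ^+ 2 + 1)).
  by field; rewrite gt_eqF // ltr_wpDl ?sqr_ge0.
apply: ler_piMr; first by rewrite mulr_ge0 ?sqr_ge0 // ltW.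
by rewrite ler_pdivrMr ?ltr_wpDl ?sqr_ge0 // mul1r lerDl.
Qed.

End Goursat.

(** * Mean value inequality, maximum principle and Schwarz lemma *)

Section MaximumPrinciple.
Variable R : realType.
Implicit Types (f g phi : R[i] -> R[i]) (c p q z w a b : R[i]) (r k e : R).

Lemma has_deriv_sub c w : has_deriv (fun z => z - c) w 1.
Proof.
by have := has_derivB (has_deriv_id w) (has_deriv_cst c w); rewrite subr0.
Qed.

Lemma has_deriv_inv_sub c w : w != c ->
  has_deriv (fun z => (z - c)^-1) w (- 1 / (w - c) ^+ 2).
Proof.
move=> wc; apply: (@has_deriv_inv _ (fun z => z - c)); first by rewrite subr_eq0.
exact: has_deriv_sub.
Qed.

(* Goursat for phi (c + expC w) on [ln r', ln r] x [0, 2 pi]: by periodicity the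
   horizontal sides cancel, so the averages of phi over the circles of radii r
   and r' about c agree in the limit; the latter is close to phi c. *)
Lemma mean_value_le phi c r k : 0 < r -> {for c, continuous phi} ->
  (forall z, z != c -> cabs (z - c) <= r -> exists a, has_deriv phi z a) ->
  (forall z, cabs (z - c) = r -> complex.Re (phi z) <= k) ->
  complex.Re (phi c) <= k.
Proof.
move=> r0 /continuous_atP cphi dphi hk; rewrite leNgt; apply/negP => kc.
(* One [e] is lost between the two circles and one between the small circle and [c]; together they
   stay below the gap [3 e]. *)
pose e := (complex.Re (phi c) - k) / 3.
have e0 : 0 < e by rewrite divr_gt0 // subr_gt0.
have [d d0 hd] := cphi e e0.
pose r' := Order.min (d / 2) r.
have r'0 : 0 < r' by rewrite lt_min r0 divr_gt0.
have r'r : r' <= r by rewrite ge_min lexx orbT.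
have r'd : r' < d.
  by apply: (@le_lt_trans _ _ (d / 2)); rewrite ?ge_min ?lexx //
    ltr_pdivrMr // ltr_pMr // ltr1n.
have lr'r : ln r' <= ln r by rewrite ler_ln ?posrE.
pose psi w := phi (c + expC w).
pose p := (ln r')%:C; pose s := (ln r - ln r')%:C; pose t : R[i] := 0 +i* (2 * pi).
have psit w : psi (w + t) = psi w by rewrite /psi expC_2pi.
have dpsi w : complex.Re w <= ln r -> exists a, has_deriv psi w a.
  move=> hw; have [||a da] := dphi (c + expC w).
  - by rewrite -subr_eq0 addrC addKr expC_neq0.
  - by rewrite addrC addKr cabs_expC -ler_ln ?posrE ?expR_gt0 // expRK.
  exists (a * (0 + expC w)).
  exact: (has_deriv_comp (has_derivD (has_deriv_cst c w) (has_deriv_expC w)) da).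
have dpsi_rect (x y : R) : 0 <= x <= 1 -> 0 <= y <= 1 ->
    exists d, has_deriv psi (p + x%:C * s + y%:C * t) d.
  move=> /andP[x0 x1] _; apply: dpsi; rewrite !ReD !ReZ /= mulr0 addr0.
  rewrite -lerBrDl ler_piMl // subr_ge0 //.
have [N /(_ N (leqnn N))] := goursat dpsi_rect e0.
have ps : p + s = (ln r)%:C by rewrite /p /s -rmorphD /= addrC subrK.
have -> : par_int N psi p s t =
    t * (seg_avg N psi (p + s) (p + s + t) - seg_avg N psi p (p + t)).
  rewrite /par_int /seg_int.
  have -> : seg_avg N psi (p + s + t) (p + t) = seg_avg N psi p (p + s).
    by rewrite seg_avg_shift // seg_avgC.
  by rewrite (seg_avgC N psi (p + t) p); ring.
rewrite normcM => he.
(* Since [2 pi >= 1], the bound on [t (X - Y)] also bounds [X - Y]. *)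
have t1 : 1 <= cabs t.
  apply: le_trans (abs_Im t); rewrite /= ger0_norm; last first.
    by rewrite mulr_ge0 // pi_ge0.
  by have := @pi_ge2 R; lra.
set X := seg_avg N psi (p + s) (p + s + t) in he.
set Y := seg_avg N psi p (p + t) in he.
have {}he : cabs (X - Y) <= e.
  by apply: le_trans he; rewrite ler_peMl ?cabs_ge0.
have Xk : complex.Re X <= k.
  apply: (seg_avg_convex N (midpoint_convex_Re_eq (b := ln r))
    (midpoint_convex_Re_le (b := k))) => [w hw||].
  - by apply: hk; rewrite addrC addKr cabs_expC hw lnK ?posrE.
  - by rewrite ps.
  - by rewrite ps /= addr0.
have Yk : complex.Re (phi c) - e <= complex.Re Y.
  apply: (seg_avg_convex N (midpoint_convex_Re_eq (b := ln r'))
    (midpoint_convex_Re_ge (b := complex.Re (phi c) - e))) => [w hw||].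
  - rewrite lerBlDr -lerBlDl -ReB; apply: le_trans (Re_le_cabs _) _.
    rewrite cabs_distC ltW // hd // addrC addKr cabs_expC hw lnK ?posrE //.
  - by [].
  - by rewrite /= addr0.
have := le_trans (Re_le_cabs (Y - X)) (_ : _ <= e).
rewrite cabs_distC ReB => /(_ he); move: (complex.Re X) (complex.Re Y) Xk Yk.
rewrite /e => u v; lra.
Qed.

Lemma closed_disk_compact c r : compact [set w : R[i] | cabs (w - c) <= r].
Proof.
apply: (@subclosed_compact _ _ [set w : R[i] | cabs w <= r + cabs c]).
- have -> : [set w | cabs (w - c) <= r] =
    (fun w => w - c) @^-1` [set w | cabs w <= r] by [].
  apply: preimage_closed; last exact: closed_cabs.
  move=> z _; apply: has_deriv_continuous (has_deriv_sub c z).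
- exact: compact_cabs.
- move=> w /= hw; have := cabs_leB w c; lra.
Qed.

Definition Rcontinuous_at (u : R[i] -> R) z : Prop := forall e, 0 < e ->
  exists2 d : R, 0 < d & forall w, cabs (w - z) < d -> `|u w - u z| < e.

Lemma Rcontinuous_atP (u : R[i] -> R) z :
  Rcontinuous_at u z <-> {for z, continuous u}.
Proof.
split.
- move=> h; apply/(@cvgrPdist_lt _ R _ (nbhs z) _) => e /h[d d0 hd].
  by apply/nbhs_diskP; exists d => // w /hd; rewrite distrC.
- move=> /(@cvgrPdist_lt _ R _ (nbhs z) _) h e /h/nbhs_diskP[d d0 hd].
  by exists d => // w /hd /=; rewrite distrC.
Qed.

Lemma Rcontinuous_at_Re f z : {for z, continuous f} ->
  Rcontinuous_at (fun w => complex.Re (f w)) z.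
Proof.
move=> /continuous_atP cf e /cf[d d0 hd]; exists d => // w /hd.
by apply: le_lt_trans; rewrite -ReB abs_Re.
Qed.

Lemma Rcontinuous_at_cabs f z : {for z, continuous f} ->
  Rcontinuous_at (fun w => cabs (f w)) z.
Proof.
move=> /continuous_atP cf e /cf[d d0 hd]; exists d => // w /hd.
apply: le_lt_trans; rewrite ler_norml cabs_leB lerNl opprB.
by rewrite cabs_distC cabs_leB.
Qed.

Lemma compact_max (A : set R[i]) (u : R[i] -> R) : A !=set0 -> compact A ->
  (forall z, A z -> Rcontinuous_at u z) ->
  exists2 z, A z & forall w, A w -> u w <= u z.
Proof.
move=> A0 cA cu.
have [|z zA hz] := compact_EVT_max A0 cA (f := u).
  apply: continuous_in_subspaceT => z /set_mem /cu.
  by move=> /Rcontinuous_atP.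
exists z; first exact: set_mem.
by move=> w wA; apply: hz; exact: mem_set.
Qed.

Lemma compact_min (A : set R[i]) (u : R[i] -> R) : A !=set0 -> compact A ->
  (forall z, A z -> Rcontinuous_at u z) ->
  exists2 z, A z & forall w, A w -> u z <= u w.
Proof.
move=> A0 cA cu; have [|z Az hz] := @compact_max A (fun w => - u w) A0 cA.
  move=> z /cu h e /h[d d0 hd]; exists d => // w /hd.
  by rewrite -opprD normrN.
by exists z => // w /hz; rewrite lerN2.
Qed.

(* An isolated point of non-differentiability is allowed, so that difference
   quotients qualify without a removable singularity theorem. *)
Definition almost_holomorphic_at phi z : Prop := 
  {for z, continuous phi} /\ exists2 d : R, 0 < d &
  forall w, w != z -> cabs (w - z) < d ->
    exists a, has_deriv phi w a.

(* Adding e |z - c|^2 makes the real part strictly subharmonic, so that its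
   maximum cannot be interior. *)
Lemma maximum_Re phi c r k : 0 < r ->
  (forall z, cabs (z - c) <= r -> {for z, continuous phi}) ->
  (forall z, cabs (z - c) < r -> almost_holomorphic_at phi z) ->
  (forall z, cabs (z - c) = r -> complex.Re (phi z) <= k) ->
  forall z, cabs (z - c) <= r -> complex.Re (phi z) <= k.
Proof.
move=> r0 cphi dphi hk z hz.
suff h e : 0 < e -> complex.Re (phi z) <= k + e * r ^+ 2.
  apply/ler_addgt0Pr => e e0; have := h (e / r ^+ 2).
  by rewrite divfK ?gt_eqF ?exprn_gt0 //; apply; rewrite divr_gt0 // exprn_gt0.
move=> e0; pose v w := complex.Re (phi w) + e * cabs (w - c) ^+ 2.
suff [p pr hp] : exists2 p, cabs (p - c) = r &
    forall w, cabs (w - c) <= r -> v w <= v p.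
  have := hp z hz; rewrite /v pr; have := hk p pr.
  have : 0 <= e * cabs (z - c) ^+ 2 by rewrite mulr_ge0 ?sqr_ge0 // ltW.
  lra.
have [||p /= hpr hp] := compact_max (u := v) _ (@closed_disk_compact c r).
- by exists c; rewrite /= subrr normc0 ltW.
- move=> w /= hw; apply/Rcontinuous_atP.
  have cc : {for w, continuous (fun w => w - c)}.
    exact: has_deriv_continuous (has_deriv_sub c w).
  have /Rcontinuous_atP c1 := Rcontinuous_at_Re (cphi w hw).
  have /Rcontinuous_atP c2 := Rcontinuous_at_cabs cc.
  rewrite /v.
  exact: (cvgD c1 (cvgM (@cvg_cst _ e _ _ _) (cvgM c2 c2))).
exists p => //; apply/eqP; rewrite eq_le hpr leNgt; apply/negP => prlt.
have [cp [d d0 hd]] := dphi p prlt.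
(* The linear term reproduces [e] times the cross term in the expansion of [|w - c|^2] about [p].
   Maximality of [v] at [p] then puts [Re phi1] at least [e s^2] below its value at [p] on the whole
   circle of radius [s], against the mean value inequality. *)
pose q := p - c; pose b : R[i] := (2 * e)%:C * (q^*)%C.
pose phi1 w := phi w + b * (w - p).
pose s := Order.min (d / 2) (r - cabs q).
have s0 : 0 < s by rewrite lt_min subr_gt0 prlt divr_gt0.
have sd : s < d.
  by apply: (@le_lt_trans _ _ (d / 2)); rewrite ?ge_min ?lexx //
    ltr_pdivrMr // ltr_pMr // ltr1n.
have sr : s <= r - cabs q by rewrite ge_min lexx orbT.
have dlin w : has_deriv (fun w => b * (w - p)) w (b * 1).
  exact: has_derivZ _ (has_deriv_sub p w).
have : complex.Re (phi1 p) <= complex.Re (phi p) - e * s ^+ 2.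
  apply: (@mean_value_le phi1 p s _ s0).
  - exact: (cvgD cp (has_deriv_continuous (dlin p))).
  - move=> w wp ws; have [a da] := hd w wp (le_lt_trans ws sd).
    by exists (a + b * 1); exact: has_derivD.
  - move=> w ws; have wr : cabs (w - c) <= r.
      by have := cabs_distD p w c; rewrite ws -/q; lra.
    have := hp w wr; rewrite /v /phi1 ReD.
    have -> : cabs (w - c) ^+ 2 = cabs q ^+ 2 + s ^+ 2 +
      complex.Re (2%:C * (q^*)%C * (w - p)).
      rewrite -ws !cabs_sqr (_ : w - c = (w - p) + q); last by rewrite /q; ring.
      move: (w - p) (q) => [x y] [x' y'] /=; ring.
    rewrite /b (_ : (2 * e)%:C * (q^*)%C * (w - p) = e%:C * (2%:C * (q^*)%C * (w - p))).
      by rewrite ReZ -/q; lra.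
    by rewrite rmorphM /=; ring.
rewrite /phi1 subrr mulr0 addr0 lerBrDr gerDl leNgt.
by rewrite mulr_gt0 // exprn_gt0.
Qed.

(** Multiplying by the conjugate of [phi z0] makes the value at [z0] real and nonnegative, so the
    principle for real parts applies. *)
Lemma maximum_modulus phi c r k : 0 < r ->
  (forall z, cabs (z - c) <= r -> {for z, continuous phi}) ->
  (forall z, cabs (z - c) < r -> almost_holomorphic_at phi z) ->
  (forall z, cabs (z - c) = r -> cabs (phi z) <= k) ->
  forall z, cabs (z - c) <= r -> cabs (phi z) <= k.
Proof.
move=> r0 cphi dphi hk z0 hz0.
have k0 : 0 <= k.
  apply: le_trans (cabs_ge0 (phi (c + r%:C))) (hk _ _).
  by rewrite addrC addKr cabs_real gtr0_norm.
have [->|nz] := eqVneq (phi z0) 0; first by rewrite normc0.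
pose b := ((phi z0)^*)%C.
have cb : cabs b = cabs (phi z0) by rewrite /b; case: (phi z0) => x y /=; rewrite sqrrN.
have : complex.Re (b * phi z0) <= k * cabs (phi z0).
  apply: (@maximum_Re (fun w => b * phi w) c r _ r0 _ _ _ z0 hz0).
  - move=> z /cphi h; exact: (cvgM (@cvg_cst _ b _ _ _) h).
  - move=> z /dphi[h [d d0 hd]]; split; first exact: (cvgM (@cvg_cst _ b _ _ _) h).
    exists d => // w wz /hd -/(_ wz)[a da]; exists (b * a).
    exact: has_derivZ.
  - move=> z /hk h; apply: le_trans (Re_le_cabs _) _.
    by rewrite normcM cb mulrC ler_wpM2r // cabs_ge0.
have -> : complex.Re (b * phi z0) = cabs (phi z0) * cabs (phi z0).
  by rewrite -expr2 cabs_sqr /b; case: (phi z0) => x y /=; ring.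
by rewrite ler_pM2r // cabs_gt0.
Qed.

Lemma holomorphic_disk_almost phi c r :
  (forall z, cabs (z - c) < r -> exists a, has_deriv phi z a) ->
  forall z, cabs (z - c) < r -> almost_holomorphic_at phi z.
Proof.
move=> h z hz; split; first by have [a] := h z hz; exact: has_deriv_continuous.
exists (r - cabs (z - c)); first by rewrite subr_gt0.
move=> w _ hw; apply: h; have := cabs_distD z w c; lra.
Qed.

(** Passes estimates on disks of radius [s < r] to the open disk of radius [r], on whose boundary
    nothing is assumed. *)
Lemma ler_mul_limit (x k r0 r : R) : r0 < r ->
  (forall s, r0 < s -> s < r -> x * s <= k) -> x * r <= k.
Proof.
move=> r0r h; apply/ler_addgt0Pr => e e0.
pose d := Order.min ((r - r0) / 2) (e / (`|x| + 1)).
have x1 : 0 < `|x| + 1 by rewrite ltr_wpDl.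
have d0 : 0 < d by rewrite lt_min !divr_gt0 // subr_gt0.
have dr : d <= (r - r0) / 2 by rewrite ge_min lexx.
have de : d <= e / (`|x| + 1) by rewrite ge_min lexx orbT.
have := h (r - d); rewrite mulrBr => hh.
have : x * d <= e.
  rewrite ler_pdivlMr // in de; apply: le_trans de.
  by rewrite mulrC ler_wpM2l ?ltW //; have := ler_norm x; lra.
by have := hh; lra.
Qed.

(** Maximum modulus for the Caratheodory quotient [Q] of [phi] at [c], on radii [s < r] tending to
    [r]. The weak regularity asked of [phi] makes the lemma applicable to difference quotients. *)
Lemma schwarz phi c a r k : 0 < r ->
  (forall z, cabs (z - c) < r -> almost_holomorphic_at phi z) ->
  (forall z, cabs (z - c) < r -> cabs (phi z) <= k) ->
  phi c = 0 -> has_deriv phi c a ->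
  cabs a * r <= k /\
  forall z, cabs (z - c) < r -> cabs (phi z) * r <= k * cabs (z - c).
Proof.
move=> r0 hphi hk phic [Q [phiQ cQ Qa]].
have {}phiQ w : phi w = (w - c) * Q w by rewrite phiQ phic add0r.
have QE w : w != c -> Q w = (w - c)^-1 * phi w.
  by move=> wc; rewrite phiQ mulKf // subr_eq0.
have dQ w b : w != c -> has_deriv phi w b -> exists b', has_deriv Q w b'.
  move=> wc db; have wc' : w - c != 0 by rewrite subr_eq0.
  have := has_derivM (has_deriv_inv_sub wc) db.
  set b' := (X in has_deriv _ _ X) => h; exists b'; apply: has_deriv_near h.
  apply/nbhs_diskP; exists (cabs (w - c)); first by rewrite cabs_gt0.
  move=> z hz; rewrite QE //; apply/eqP => zc; move: hz.
  by rewrite /disk /mkset zc cabs_distC ltxx.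
have cQ' w : cabs (w - c) < r -> {for w, continuous Q}.
  move=> wr; have [->//|wc] := eqVneq w c.
  have wc' : w - c != 0 by rewrite subr_eq0.
  have [cphi _] := hphi w wr.
  have cI := has_deriv_continuous (has_deriv_inv_sub wc).
  have cP : {for w, continuous (fun w => (w - c)^-1 * phi w)} by exact: (cvgM cI cphi).
  apply/continuous_atP => e e0; move/continuous_atP: cP => /(_ e e0)[d d0 hd].
  exists (Order.min d (cabs (w - c))); first by rewrite lt_min d0 cabs_gt0.
  move=> z; rewrite lt_min => /andP[/hd h1 h2]; rewrite !QE //.
  by apply/eqP => zc; move: h2; rewrite zc cabs_distC ltxx.
have key z : cabs (z - c) < r -> cabs (Q z) * r <= k.
  move=> zr; apply: (ler_mul_limit zr) => s zs sr.
  have s0 : 0 < s by apply: le_lt_trans zs; exact: cabs_ge0.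
  rewrite -ler_pdivlMr //.
  apply: (@maximum_modulus Q c s _ s0 _ _ _ z (ltW zs)).
  - by move=> w ws; apply: cQ'; exact: le_lt_trans ws sr.
  - move=> w ws; have wr := lt_trans ws sr; split; first exact: cQ'.
    have [_ [d d0 hd]] := hphi w wr.
    have [->|wc] := eqVneq w c.
      have [_ [d' d'0 hd']] : almost_holomorphic_at phi c.
        by apply: hphi; rewrite subrr normc0.
      by exists d' => // z' zc /hd' -/(_ zc)[b]; exact: dQ.
    exists (Order.min d (cabs (w - c))); first by rewrite lt_min d0 cabs_gt0 subr_eq0.
    move=> z' zw; rewrite lt_min => /andP[/hd -/(_ zw)[b db] h2]; apply: dQ db.
    by apply/eqP => zc; move: h2; rewrite zc cabs_distC ltxx.
  - move=> w ws; rewrite ler_pdivlMr // -ws mulrC -normcM -phiQ.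
    by apply: hk; rewrite ws.
split; first by rewrite -Qa; apply: key; rewrite subrr normc0.
by move=> z zr; rewrite phiQ normcM -mulrA mulrC ler_wpM2r ?cabs_ge0 // key.
Qed.

End MaximumPrinciple.

(** * Schwarz, Harnack and Hopf estimates for positive real part *)

Section Harnack.
Variable R : realType.
Implicit Types (F dF : R[i] -> R[i]) (c p z w a b : R[i]) (r d k e : R).

Lemma cabs_le_sqr z w : cabs z ^+ 2 <= cabs w ^+ 2 -> cabs z <= cabs w.
Proof. by rewrite ler_sqr ?nnegrE ?cabs_ge0. Qed.

(* Schwarz lemma for the Cayley transform (F - F c) / (F + conj (F c)). *)
Lemma schwarz_half_plane F dF c d : 0 < d ->
  (forall z, cabs (z - c) < d -> has_deriv F z (dF z)) ->
  (forall z, cabs (z - c) < d -> 0 < complex.Re (F z)) ->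
  cabs (dF c) * d <= 2 * complex.Re (F c) /\
  forall z, cabs (z - c) < d ->
    complex.Re (F c) * (d - cabs (z - c)) <= complex.Re (F z) * (d + cabs (z - c)).
Proof.
move=> d0 hF F0; have cd : cabs (c - c) < d by rewrite subrr normc0.
set b := ((F c)^*)%C; set x := complex.Re (F c).
have x0 : 0 < x by exact: F0.
have Reb : complex.Re b = x by rewrite /b /x; case: (F c).
have bc : F c + b = (2 * x)%:C.
  rewrite /b /x; case: (F c) => y y'; apply/eqP.
  by rewrite eq_complex /= addrN eqxx andbT -mulr2n mulr_natl.
have nz z : cabs (z - c) < d -> F z + b != 0.
  move=> /F0 Fz; apply/eqP => /(congr1 (@complex.Re R)); rewrite ReD Reb /=; lra.
pose phi z := (F z - F c) * (F z + b)^-1.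
have dphi z : cabs (z - c) < d -> has_deriv phi z
    ((dF z - 0) * (F z + b)^-1 + (F z - F c) * (- (dF z + 0) / (F z + b) ^+ 2)).
  move=> zd; apply: has_derivM; first exact: has_derivB (hF z zd) (has_deriv_cst _ _).
  apply: (@has_deriv_inv _ (fun w => F w + b)); first exact: nz.
  exact: has_derivD (hF z zd) (has_deriv_cst _ _).
(* This identity shows that the Cayley transform has modulus at most 1 where [Re F > 0], and later
   turns the Schwarz bound into Harnack's inequality. *)
have sq z : cabs (F z + b) ^+ 2 = cabs (F z - F c) ^+ 2 + 4 * complex.Re (F z) * x.
  rewrite !cabs_sqr /b /x; case: (F z) (F c) => [u v] [u' v'] /=; ring.
have phic : phi c = 0 by rewrite /phi subrr mul0r.
have [||h1 h2] := schwarz (k := 1) d0 _ _ phic (dphi c cd).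
- apply: holomorphic_disk_almost => z zd; eexists; exact: dphi z zd.
- move=> z zd; rewrite /phi normcM normcV ler_pdivrMr ?cabs_gt0 ?nz // mul1r.
  by apply: cabs_le_sqr; rewrite sq lerDl mulr_ge0 ?mulr_ge0 ?ltW ?F0.
split.
  move: h1; rewrite subrr mul0r addr0 subr0 normcM normcV bc cabs_real.
  rewrite gtr0_norm ?mulr_gt0 // mulrAC ler_pdivrMr ?mulr_gt0 //.
  by rewrite mul1r.
move=> z zd; have := h2 z zd; rewrite mul1r /phi normcM normcV.
rewrite mulrAC ler_pdivrMr ?cabs_gt0 ?nz //.
set t := cabs (z - c) in zd *; set u := complex.Re (F z).
have u0 : 0 < u by exact: F0.
have t0 : 0 <= t by exact: cabs_ge0.
move=> h; have {}h : (cabs (F z - F c) * d) ^+ 2 <= (t * cabs (F z + b)) ^+ 2.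
  by rewrite ler_sqr ?nnegrE ?mulr_ge0 ?cabs_ge0 // ltW.
rewrite !exprMn sq -/u in h.
(* The Schwarz bound reads [A (d^2 - t^2) <= 4 t^2 u x]; replacing [A] by the smaller [(u - x)^2]
   and completing the square gives [d |u - x| <= t (u + x)]. *)
have hA : (u - x) ^+ 2 <= cabs (F z - F c) ^+ 2.
  by rewrite cabs_sqr -ReB lerDl sqr_ge0.
move: (cabs (F z - F c) ^+ 2) h hA => A h hA.
have h3 : (d * (u - x)) ^+ 2 <= (t * (u + x)) ^+ 2.
  have : (u - x) ^+ 2 * (d ^+ 2 - t ^+ 2) <= A * (d ^+ 2 - t ^+ 2).
    rewrite ler_wpM2r // subr_ge0 ler_sqr ?nnegrE // ltW //.
  rewrite !exprMn; lra.
have : d * (x - u) <= t * (u + x).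
  apply: le_trans (ler_norm _) _.
  have tu : 0 <= t * (u + x) by rewrite mulr_ge0 // addr_ge0 // ltW.
  by rewrite -opprB mulrN normrN -[leRHS]ger0_norm // -ler_sqr ?nnegrE //
    !real_normK ?num_real.
lra.
Qed.

(** At distance [s d] from [p] on the radius towards [c], Harnack keeps [Re F] above
    [s Re (F c) / 2], while differentiability at [p] keeps it below [s d |F' p| + o(s)]. *)
Lemma hopf F dF c p d : 0 < d ->
  (forall z, cabs (z - c) < d -> has_deriv F z (dF z)) ->
  (forall z, cabs (z - c) < d -> 0 < complex.Re (F z)) ->
  cabs (p - c) = d -> has_deriv F p (dF p) -> complex.Re (F p) = 0 ->
  complex.Re (F c) <= 2 * d * cabs (dF p).
Proof.
move=> d0 hF F0 pd /has_derivP dp Fp0.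
have [_ harnack] := schwarz_half_plane d0 hF F0.
have x0 : 0 < complex.Re (F c) by apply: F0; rewrite subrr normc0.
set x := complex.Re (F c) in harnack x0 *.
apply/ler_addgt0Pr => e e0.
have [|e' e'0 he] := dp (e / (2 * d)); first by rewrite divr_gt0 // mulr_gt0.
(* The first bound keeps [w] well inside the disk about [c], the second keeps it within [e'] of
   [p]. *)
pose s := Order.min (2^-1) (e' / (2 * d)).
have s0 : 0 < s by rewrite lt_min invr_gt0 ltr0n divr_gt0 // mulr_gt0.
have s1 : s <= 2^-1 by rewrite ge_min lexx.
have se : s * (2 * d) <= e' by rewrite -ler_pdivlMr ?mulr_gt0 // ge_min lexx orbT.
clearbody s.
have ds0 : 0 < s * d by rewrite mulr_gt0.
pose w := p + s%:C * (c - p).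
have wp : cabs (w - p) = s * d.
  by rewrite /w addrC addKr normcM cabs_real gtr0_norm // cabs_distC pd.
have wc : cabs (w - c) = (1 - s) * d.
  have -> : w - c = (1 - s)%:C * (p - c) by rewrite /w rmorphB /=; ring.
  by rewrite normcM cabs_real ger0_norm ?pd // subr_ge0; lra.
have := harnack w; rewrite wc => /(_ _)/wrap[|h1]; first by lra.
have := he w; rewrite wp => /(_ _)/wrap[|h2]; first by lra.
have h3 : complex.Re (F w) <= s * d * cabs (dF p) + e / (2 * d) * (s * d).
  have -> : F w = (F w - F p - (w - p) * dF p) + (w - p) * dF p + F p by ring.
  rewrite 2!ReD Fp0 addr0 addrC lerD //.
    by apply: le_trans (Re_le_cabs _) _; rewrite normcM wp.
  exact: le_trans (Re_le_cabs _) h2.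
have h4 : e / (2 * d) * (s * d) = s * (e / 2) by field; rewrite gt_eqF.
rewrite h4 in h3; set y := complex.Re (F w) in h1 h3.
have h5 : x * s <= 2 * y.
  have {}h1 : d * (x * s) <= d * (y * (2 - s)) by lra.
  rewrite ler_pM2l // in h1; apply: le_trans h1 _.
  have y0 : 0 < y by apply: F0; rewrite wc; lra.
  have : 0 < y * s by rewrite mulr_gt0.
  lra.
rewrite -(ler_pM2l s0); lra.
Qed.

End Harnack.

(** * Zeros of the real part and bounds on the derivative *)

Section SchlichtDisk.
Variable R : realType.
Implicit Types (F dF : R[i] -> R[i]) (c p z w a b : R[i]) (r d k e : R).

(** A change of sign would produce a zero on the segment from [c] to [z], by the intermediate value
    theorem. *)
Lemma Re_gt0_disk F c r :
  (forall z, cabs (z - c) < r -> {for z, continuous F}) ->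
  (forall z, cabs (z - c) < r -> complex.Re (F z) != 0) ->
  0 < complex.Re (F c) ->
  forall z, cabs (z - c) < r -> 0 < complex.Re (F z).
Proof.
move=> cF nF Fc z zr; rewrite ltNge; apply/negP => Fz.
pose l t := c + t%:C * (z - c).
have lr t : t \in `[0, 1] -> cabs (l t - c) < r.
  rewrite in_itv /= => /andP[t0 t1]; rewrite /l addrC addKr normcM cabs_real ger0_norm //.
  by apply: le_lt_trans zr; rewrite ler_piMl // cabs_ge0.
have [||t t01 Ft] := @IVT R (fun t => complex.Re (F (l t))) 0 1 0 ler01.
- apply: continuous_in_subspaceT => t /set_mem /= t01.
  apply/(@cvgrPdist_lt _ R _ (nbhs t) _) => e e0.
  have [d d0 hd] := Rcontinuous_at_Re (cF _ (lr t t01)) e0.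
  have k0 : 0 < cabs (z - c) + 1 by rewrite ltr_wpDl // cabs_ge0.
  apply/nbhs_ballP; exists (d / (cabs (z - c) + 1)); first by rewrite /= divr_gt0.
  move=> t'; rewrite /ball /= distrC ltr_pdivlMr // => tt'; rewrite distrC.
  apply: hd; have -> : l t' - l t = (t' - t)%:C * (z - c).
    by rewrite /l rmorphB /=; ring.
  rewrite normcM cabs_real; apply: le_lt_trans tt'.
  by rewrite ler_wpM2l // lerDl.
- have -> : l 0 = c by rewrite /l mul0r addr0.
  have -> : l 1 = z by rewrite /l mul1r addrC subrK.
  by rewrite ge_min le_max Fz orbT (ltW Fc).
by have := nF _ (lr t t01); rewrite Ft eqxx.
Qed.

Lemma compact_zeros F c r :
  (forall z, cabs (z - c) <= r -> {for z, continuous F}) ->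
  compact [set z | cabs (z - c) <= r /\ complex.Re (F z) = 0].
Proof.
move=> cF; apply: (@subclosed_compact _ _ [set z : R[i] | cabs (z - c) <= r]).
- move=> z clz; have zr : cabs (z - c) <= r.
    rewrite leNgt; apply/negP => rz.
    have [|w [[wr _] /= hw]] := clz (disk z (cabs (z - c) - r)).
      by apply/nbhs_diskP; exists (cabs (z - c) - r); rewrite ?subr_gt0.
    rewrite /disk /mkset cabs_distC in hw; have := cabs_distD w z c; lra.
  split=> //; apply/eqP; rewrite -normr_le0 leNgt; apply/negP => Fz.
  have [d d0 hd] := Rcontinuous_at_Re (cF z zr) Fz.
  have [|w [[_ Fw] hw]] := clz (disk z d); first by apply/nbhs_diskP; exists d.
  by have := hd w hw; rewrite Fw sub0r normrN ltxx.
- exact: closed_disk_compact.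
- by move=> z [].
Qed.

(** [Re F] keeps its sign; after replacing [F] by [- F] if needed, the Schwarz lemma for the
    half-plane applies. *)
Lemma deriv_bound_no_zero F dF c r : 0 < r ->
  (forall z, cabs (z - c) < r -> has_deriv F z (dF z)) ->
  (forall z, cabs (z - c) < r -> complex.Re (F z) != 0) ->
  cabs (dF c) * r <= 2 * `|complex.Re (F c)|.
Proof.
move=> r0; wlog Fc : F dF / 0 < complex.Re (F c).
  move=> h hF nF; have cc : cabs (c - c) < r by rewrite subrr normc0.
  have [Fc|Fc] := ltP 0 (complex.Re (F c)); first exact: h.
  have := h (fun z => - F z) (fun z => - dF z).
  rewrite normcN ReN normrN oppr_gt0; apply.
  - by rewrite lt_neqAle Fc nF.
  - by move=> z /hF; exact: has_derivN.
  - by move=> z /nF; rewrite ReN oppr_eq0.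
move=> hF nF; have F0 : forall z, cabs (z - c) < r -> 0 < complex.Re (F z).
  by apply: Re_gt0_disk => // z /hF; exact: has_deriv_continuous.
by have [+ _] := schwarz_half_plane r0 hF F0; rewrite gtr0_norm.
Qed.

(* Let p be the zero of Re F closest to c and d = |p - c|: the Hopf lemma bounds
   |Re F c| by 2 d |F' p|, and Schwarz bounds |F' c| by 2 |Re F c| / d. *)
Lemma deriv_bound_zero F dF c r k z0 :
  (forall z, cabs (z - c) < r -> has_deriv F z (dF z)) ->
  (forall z, cabs (z - c) < r -> complex.Re (F z) = 0 -> cabs (dF z) <= k) ->
  cabs (z0 - c) < r -> complex.Re (F z0) = 0 ->
  cabs (dF c) <= 4 * k.
Proof.
move=> hF hk z0r Fz0; have r0 : 0 < r by apply: le_lt_trans z0r; exact: cabs_ge0.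
have k0 : 0 <= k by apply: le_trans (hk z0 z0r Fz0); exact: cabs_ge0.
have cc : cabs (c - c) < r by rewrite subrr normc0.
have [Fc|Fc] := eqVneq (complex.Re (F c)) 0.
  by apply: le_trans (hk c cc Fc) _; rewrite ler_peMl // ler1n.
wlog Fc0 : F dF hF hk Fz0 Fc / 0 < complex.Re (F c).
  move=> h; have [Fc0|Fc0] := ltP 0 (complex.Re (F c)); first exact: (h F).
  have := h (fun z => - F z) (fun z => - dF z).
  rewrite normcN !ReN oppr_eq0 oppr_gt0; apply=> //.
  - by move=> z /hF; exact: has_derivN.
  - by move=> z zr; rewrite ReN normcN => /eqP; rewrite oppr_eq0 => /eqP; exact: hk.
  - by rewrite Fz0 oppr0.
  - by rewrite lt_neqAle Fc Fc0.
have sub z : cabs (z - c) <= cabs (z0 - c) -> cabs (z - c) < r.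
  by move=> h; exact: le_lt_trans h z0r.
pose u z := cabs (z - c).
have [|||p [/= pz0 Fp] hp] := @compact_min _ _ u _ (@compact_zeros F c (cabs (z0 - c)) _).
- by exists z0.
- by move=> z /sub /hF; exact: has_deriv_continuous.
- move=> z _; apply: (@Rcontinuous_at_cabs _ (fun z => z - c)).
  exact: has_deriv_continuous (has_deriv_sub c z).
have pr : cabs (p - c) < r by exact: sub.
have d0 : 0 < cabs (p - c).
  by rewrite cabs_gt0 subr_eq0; apply/eqP => pc; move: Fc; rewrite -pc Fp eqxx.
have sub' z : cabs (z - c) < cabs (p - c) -> has_deriv F z (dF z).
  by move=> h; apply: hF; exact: lt_trans h pr.
have F0 : forall z, cabs (z - c) < cabs (p - c) -> 0 < complex.Re (F z).
  apply: Re_gt0_disk => // z zp; first exact: has_deriv_continuous (sub' z zp).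
  apply/eqP => Fz; have := hp z (conj (le_trans (ltW zp) pz0) Fz).
  by rewrite /u leNgt zp.
have [h1 _] := schwarz_half_plane d0 sub' F0.
have h2 := hopf d0 sub' F0 erefl (hF p pr) Fp.
have h3 := hk p pr Fp.
rewrite -(ler_pM2r d0); apply: le_trans h1 _.
have : cabs (p - c) * cabs (dF p) <= cabs (p - c) * k by rewrite ler_wpM2l // ltW.
lra.
Qed.

(** The mean value inequality, by bisecting the segment with slope [k + e]. The second coordinate of
    [bisection] is idle. *)
Lemma lipschitz_disk F dF c r k :
  (forall z, cabs (z - c) < r -> has_deriv F z (dF z)) ->
  (forall z, cabs (z - c) < r -> cabs (dF z) <= k) ->
  forall z w, cabs (z - c) < r -> cabs (w - c) < r ->
    cabs (F w - F z) <= k * cabs (w - z).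
Proof.
move=> hF hk z w zr wr; set L := cabs (w - z).
have L0 : 0 <= L by exact: cabs_ge0.
suff h e : 0 < e -> cabs (F w - F z) <= (k + e) * L.
  apply/ler_addgt0Pr => e e0.
  have L1 : 0 < L + 1 by rewrite ltr_wpDl.
  have := h (e / (L + 1)); rewrite divr_gt0 // => /(_ isT) {}h.
  apply: le_trans h _; rewrite mulrDl lerD2l mulrAC ler_pdivrMr //.
  by rewrite ler_pM2l // lerDl.
move=> e0; pose l t := z + t%:C * (w - z).
have lB t t' : l t' - l t = (t' - t)%:C * (w - z) by rewrite /l rmorphB /=; ring.
have lr t : 0 <= t <= 1 -> cabs (l t - c) < r.
  move=> /andP[t0 t1].
  have -> : l t - c = (1 - t)%:C * (z - c) + t%:C * (w - c).
    by rewrite /l rmorphB /=; ring.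
  apply: le_lt_trans (cabsD _ _) _; rewrite !normcM !cabs_real.
  rewrite !ger0_norm ?subr_ge0 //.
  have [t00|t00] := eqVneq t 0; first by rewrite t00 subr0 mul1r mul0r addr0.
  have tpos : 0 < t by rewrite lt_neqAle eq_sym t00.
  have : t * cabs (w - c) < t * r by rewrite ltr_pM2l.
  have : (1 - t) * cabs (z - c) <= (1 - t) * r by rewrite ler_wpM2l ?subr_ge0 // ltW.
  lra.
pose good (a b h : R) := cabs (F (l (a + h)) - F (l a)) <= (k + e) * h * L.
suff : good 0 0 1.
  rewrite /good add0r mulr1 /l mul0r addr0 mul1r.
  by have -> : z + (w - z) = w by ring.
apply: (@bisection R good) => [a b h h0 h1 h2 _ _|a0 b0 ha0 _].
  rewrite /good; have := cabs_distD (F (l (a + h / 2))) (F (l (a + h))) (F (l a)).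
  move: h1 h2; rewrite /good (_ : a + h / 2 + h / 2 = a + h); last by field.
  by lra.
have /has_derivP/(_ _ e0)[d d0 hd] := hF _ (lr _ ha0).
have L1 : 0 < L + 1 by rewrite ltr_wpDl.
exists (d / (L + 1)); first by rewrite divr_gt0.
move=> a b h /andP[h0 hdl] /andP[aa0 aa1] _ a_ge0 ah1 _ _; rewrite /good.
rewrite ltr_pdivlMr // in hdl.
have near t : `|t - a0| <= h -> cabs (l t - l a0) < d.
  move=> ht; rewrite lB normcM cabs_real; apply: le_lt_trans hdl.
  by rewrite ler_pM ?normr_ge0 // lerDl.
have bound t : `|t - a0| <= h ->
    cabs (F (l t) - F (l a0) - (l t - l a0) * dF (l a0)) <= e * (`|t - a0| * L).
  by move=> /near /hd; rewrite lB [cabs (_ * (w - z))]normcM cabs_real.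
have b1 := bound (a + h); have b2 := bound a.
have -> : F (l (a + h)) - F (l a) =
    (F (l (a + h)) - F (l a0) - (l (a + h) - l a0) * dF (l a0))
    - (F (l a) - F (l a0) - (l a - l a0) * dF (l a0))
    + h%:C * (w - z) * dF (l a0).
  by rewrite !lB !rmorphB !rmorphD /=; ring.
apply: le_trans (cabsD _ _) _; apply: le_trans (lerD (cabsB _ _) (lexx _)) _.
rewrite !normcM cabs_real gtr0_norm //.
have n1 : `|a + h - a0| = a + h - a0 by rewrite ger0_norm // subr_ge0.
have n2 : `|a - a0| = a0 - a by rewrite distrC ger0_norm // subr_ge0.
have := b1; rewrite n1 => /(_ _)/wrap[|{}b1]; first by lra.
have := b2; rewrite n2 => /(_ _)/wrap[|{}b2]; first by lra.
have b3 : h * L * cabs (dF (l a0)) <= h * L * k.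
  by rewrite ler_wpM2l ?mulr_ge0 // ?(ltW h0) // hk // lr.
apply: le_trans (lerD (lerD b1 b2) b3) _.
by rewrite le_eqVlt; apply/orP; left; apply/eqP; ring.
Qed.

End SchlichtDisk.

(** * Difference quotients, Landau's theorem and the bound on zeros of the real part *)

Section Landau.
Variable R : realType.
Implicit Types (F dF : R[i] -> R[i]) (c p z w a b : R[i]) (r d k e : R).

Definition dquot F dF z w := if w == z then dF z else (F w - F z) / (w - z).

Lemma dquotE F dF z w : F w = F z + (w - z) * dquot F dF z w.
Proof.
rewrite /dquot; case: eqVneq => [->|wz]; first by rewrite subrr mul0r addr0.
by rewrite mulrC divfK ?subr_eq0 // addrC subrK.
Qed.

Lemma dquotC F dF z w : dquot F dF z w = dquot F dF w z.
Proof.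
rewrite /dquot eq_sym; case: eqVneq => [->//|wz].
by rewrite -[LHS]mulrNN -invrN !opprB.
Qed.

Lemma dquot_continuous F dF z : has_deriv F z (dF z) ->
  {for z, continuous (dquot F dF z)}.
Proof.
move=> [Q [FQ cQ Qz]]; rewrite (_ : dquot F dF z = Q) //.
apply/funext => w; rewrite /dquot; case: eqVneq => [->//|wz].
by rewrite FQ [F z + _]addrC addrK mulrC mulKf // subr_eq0.
Qed.

Lemma dquot_has_deriv F dF z w a : w != z -> has_deriv F w a ->
  exists b, has_deriv (dquot F dF z) w b.
Proof.
move=> wz dFw; have := has_derivM (has_derivB dFw (has_deriv_cst (F z) w))
  (has_deriv_inv_sub wz).
set b := (X in has_deriv _ _ X) => h; exists b; apply: has_deriv_near h.
apply/nbhs_diskP; exists (cabs (w - z)); first by rewrite cabs_gt0 subr_eq0.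
move=> v hv; rewrite /dquot ifN //; apply/eqP => vz; move: hv.
by rewrite /disk /mkset vz cabs_distC ltxx.
Qed.

(** The point [w = z] is the exceptional one: there continuity comes from the derivative of [F], and
    differentiability is claimed only around it. *)
Lemma dquot_almost F dF c r z :
  (forall z, cabs (z - c) < r -> has_deriv F z (dF z)) ->
  cabs (z - c) < r ->
  forall w, cabs (w - c) < r -> almost_holomorphic_at (dquot F dF z) w.
Proof.
move=> hF zr w wr; split.
  have [->|wz] := eqVneq w z; first exact: dquot_continuous (hF z zr).
  by have [b] := dquot_has_deriv dF wz (hF w wr); exact: has_deriv_continuous.
have [->|wz] := eqVneq w z.
  exists (r - cabs (z - c)); first by rewrite subr_gt0.
  move=> v vz hv; apply: (dquot_has_deriv dF vz (hF v _)).
  by have := cabs_distD z v c; lra.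
exists (Order.min (r - cabs (w - c)) (cabs (w - z))).
  by rewrite lt_min subr_gt0 wr cabs_gt0 subr_eq0.
move=> v vw; rewrite lt_min => /andP[h1 h2]; apply: (dquot_has_deriv dF _ (hF v _)).
  by apply/eqP => vz; move: h2; rewrite vz cabs_distC ltxx.
by have := cabs_distD w v c; lra.
Qed.

(* The Schwarz lemma is applied to the difference quotients themselves, which
   avoids any use of a second derivative. *)
Lemma dquot_near_deriv F dF c r k : 0 < r ->
  (forall z, cabs (z - c) < r -> has_deriv F z (dF z)) ->
  (forall z, cabs (z - c) < r -> cabs (dF z) <= k) ->
  forall d, 0 < d <= r -> forall z w, cabs (z - c) < d -> cabs (w - c) < d ->
    cabs (dquot F dF z w - dF c) * r <= 6 * k * d.
Proof.
move=> r0 hF hk d /andP[d0 dr].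
have cc : cabs (c - c) < r by rewrite subrr normc0.
have k0 : 0 <= k by apply: le_trans (hk c cc); exact: cabs_ge0.
have lip := lipschitz_disk hF hk.
have qk z w : cabs (z - c) < r -> cabs (w - c) < r -> cabs (dquot F dF z w) <= k.
  move=> zr wr; rewrite /dquot; case: eqVneq => [_|wz]; first exact: hk.
  by rewrite normcM normcV ler_pdivrMr ?cabs_gt0 ?subr_eq0 // lip.
(* Schwarz in the second variable, for a function that vanishes at [c] and is bounded by [2 k];
   [z != c] provides its derivative at [c]. *)
have toc z w : z != c -> cabs (z - c) < r -> cabs (w - c) < r ->
    cabs (dquot F dF z w - dquot F dF z c) * r <= 2 * k * cabs (w - c).
  move=> zc zr wr; have cz : c != z by rewrite eq_sym.
  have [b db] := dquot_has_deriv dF cz (hF c cc).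
  have := @schwarz _ (fun w => dquot F dF z w - dquot F dF z c) c (b - 0) r (2 * k) r0.
  move=> /(_ _ _ _ _)/wrap[||||[_ ->//]].
  - move=> v vr; have [h [e e0 he]] := dquot_almost hF zr vr; split.
      exact: (cvgB h (@cvg_cst _ (dquot F dF z c) _ _ _)).
    exists e => // x xv /he -/(_ xv)[b' db']; exists (b' - 0).
    exact: has_derivB db' (has_deriv_cst _ _).
  - move=> v vr; apply: le_trans (cabsB _ _) _.
    by rewrite mulr_natl mulr2n lerD // qk.
  - by rewrite subrr.
  - exact: has_derivB db (has_deriv_cst _ _).
have tocd z w : z != c -> cabs (z - c) < d -> cabs (w - c) < d ->
    cabs (dquot F dF z w - dquot F dF z c) * r <= 2 * k * d.
  move=> zc zd wd; apply: le_trans (toc z w zc _ _) _; try exact: lt_le_trans dr.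
  by rewrite ler_wpM2l ?mulr_ge0 // ltW.
(* For base point [c] itself, a point [v] close to [c] steps in: two Schwarz steps lead from
   [dquot c z] through [dquot v z] to [dquot v c], and continuity on to [dF c]. *)
have near_c z : cabs (z - c) < d -> cabs (dquot F dF c z - dF c) * r <= 4 * k * d.
  move=> zd; have dcc : dquot F dF c c = dF c by rewrite /dquot eqxx.
  have [->|zc] := eqVneq z c.
    by rewrite dcc subrr normc0 mul0r !mulr_ge0 // ltW.
  apply/ler_addgt0Pr => e e0.
  have /continuous_atP/(_ (e / r)) := dquot_continuous (hF c cc).
  rewrite divr_gt0 // => /(_ isT)[d' d'0 hd'].
  pose m := Order.min d d' / 2.
  have m0 : 0 < m by rewrite divr_gt0 // lt_min d0.
  have : m < Order.min d d' by rewrite ltr_pdivrMr ?ltr_pMr ?ltr1n // lt_min d0.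
  rewrite lt_min => /andP[md md']; pose v := c + m%:C.
  have vm : cabs (v - c) = m by rewrite /v addrC addKr cabs_real gtr0_norm.
  have vc : v != c by rewrite -subr_eq0 -cabs_gt0 vm.
  have h1 := tocd z v zc zd (eq_ind_r (fun x => is_true (x < d)) md vm).
  have h2 := tocd v z vc (eq_ind_r (fun x => is_true (x < d)) md vm) zd.
  have := hd' v; rewrite vm => /(_ md'); rewrite dcc ltr_pdivlMr // => h3.
  rewrite (dquotC F dF z v) (dquotC F dF z c) in h1.
  rewrite (dquotC F dF v c) in h2.
  set X := dquot F dF v z in h1 h2; set Y := dquot F dF c v in h2 h3.
  have := cabs_distD X (dquot F dF c z) (dF c); rewrite (cabs_distC _ X).
  have := cabs_distD Y X (dF c) => t1 t2.
  have : cabs (dquot F dF c z - dF c) * r <=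
     (cabs (X - dquot F dF c z) + (cabs (X - Y) + cabs (Y - dF c))) * r.
    by rewrite ler_pM2r //; lra.
  by rewrite !mulrDl; lra.
move=> z w zd wd; have kd0 : 0 <= k * d by rewrite mulr_ge0 // ltW.
have [->|zc] := eqVneq z c; first by have := near_c w wd; lra.
have h1 := tocd z w zc zd wd; have h2 := near_c z zd.
rewrite (dquotC F dF z c) in h1.
have t := cabs_distD (dquot F dF c z) (dquot F dF z w) (dF c).
have : cabs (dquot F dF z w - dF c) * r <= (cabs (dquot F dF z w - dquot F dF c z) +
  cabs (dquot F dF c z - dF c)) * r by rewrite ler_pM2r.
by rewrite mulrDl; lra.
Qed.

(* A preimage of w is a minimiser of |F - w| on a closed disk about c. *)
Lemma landau F dF c r k : 0 < r -> dF c != 0 ->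
  (forall z, cabs (z - c) < r -> has_deriv F z (dF z)) ->
  (forall z, cabs (z - c) < r -> cabs (dF z) <= k) ->
  exists G : R[i] -> R[i],
    forall w, cabs (w - F c) < cabs (dF c) ^+ 2 * r / (128 * k) ->
    [/\ cabs (G w - c) < r, F (G w) = w & exists a, has_deriv G w a].
Proof.
move=> r0 nA hF hk; set A : R := cabs (dF c).
have A0 : 0 < A by rewrite cabs_gt0.
have cc : cabs (c - c) < r by rewrite subrr normc0.
have Ak : A <= k by exact: hk.
have k0 : 0 < k by exact: lt_le_trans Ak.
(* For this radius [dquot_near_deriv] gives [6 k d / r = 3 A / 8], so all difference quotients stay
   within [A / 2] of [dF c]. *)
pose d : R := A * r / (16 * k).
have d0 : 0 < d by rewrite divr_gt0 ?mulr_gt0.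
have dr : d <= r.
  rewrite ler_pdivrMr ?mulr_gt0 // mulrC; apply: ler_wpM2l; first exact: ltW.
  by apply: le_trans Ak _; lra.
have near z w : cabs (z - c) < d -> cabs (w - c) < d ->
    cabs (dquot F dF z w - dF c) <= A / 2.
  move=> zd wd; have := dquot_near_deriv r0 hF hk (d := d) _ zd wd.
  rewrite d0 dr => /(_ isT); rewrite (_ : 6 * k * d = 3 / 8 * A * r); last first.
    by rewrite /d; field; rewrite gt_eqF.
  by rewrite ler_pM2r // => h; apply: le_trans h _; lra.
have far z w : cabs (z - c) < d -> cabs (w - c) < d ->
    A / 2 <= cabs (dquot F dF z w).
  move=> zd wd; have := near z w zd wd; rewrite cabs_distC => h.
  have := cabs_leB (dF c) (dquot F dF z w); have : 0 < A by []; rewrite -/A; lra.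
have expand z w : cabs (z - c) < d -> cabs (w - c) < d ->
    A / 2 * cabs (w - z) <= cabs (F w - F z).
  move=> zd wd; rewrite (dquotE F dF z w) [F z + _]addrC addrK normcM mulrC.
  by rewrite ler_wpM2l ?cabs_ge0 // far.
set s : R := A ^+ 2 * r / (128 * k).
(* By [expand], [F] is at distance at least [A d / 4] from [F c] on the circle of radius [d / 2].
   Twice [s] is exactly that, which excludes a minimiser on the circle. *)
have sE : s = A * d / 8 by rewrite /s /d; field; rewrite gt_eqF.
have /choice[G hG] : forall w, exists z, cabs (w - F c) < s ->
    cabs (z - c) < d /\ F z = w.
  move=> w; have [ws|nws] := pselect (cabs (w - F c) < s); last by exists c => /nws.
  have cont z : cabs (z - c) <= d / 2 -> {for z, continuous F}.
    move=> zd; apply: (has_deriv_continuous (a := dF z)); apply: hF.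
    by apply: le_lt_trans zd _; apply: lt_le_trans dr; lra.
  have [||z /= zd hz] := compact_min (u := fun z => cabs (F z - w)) _
    (@closed_disk_compact _ c (d / 2)).
  - by exists c; rewrite /= subrr normc0 divr_ge0 // ltW.
  - move=> z /= zd; apply: (@Rcontinuous_at_cabs _ (fun z => F z - w)).
    exact: (cvgB (cont z zd) (@cvg_cst _ w _ _ _)).
  exists z => _; have zd' : cabs (z - c) < d by apply: le_lt_trans zd _; lra.
  split=> //; apply/eqP; rewrite -subr_eq0; apply/negPn/negP => Fzw.
  have cd : cabs (c - c) < d by rewrite subrr normc0.
  have zlt : cabs (z - c) < d / 2.
    rewrite lt_neqAle zd andbT; apply/eqP => zE.
    have h1 := expand c z cd zd'; rewrite zE in h1.
    have h2 : cabs (F z - w) <= cabs (F c - w).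
      by apply: hz; rewrite /= subrr normc0 divr_ge0 // ltW.
    rewrite (cabs_distC (F c)) in h2.
    have h3 := cabs_distD w (F z) (F c).
    rewrite sE in ws; have : A / 2 * (d / 2) = A * d / 4 by field.
    lra.
  pose y : R[i] := F z - w; have y0 : 0 < cabs y by rewrite cabs_gt0.
  have gap : 0 < d / 2 - cabs (z - c) by rewrite subr_gt0.
  (* A Newton step of length factor [t], short enough to stay in the disk: it scales the residual
     [y] by [1 - t] with an error of at most [t |y| / 2], against minimality. *)
  pose t := Order.min 1 ((d / 2 - cabs (z - c)) * A / cabs y).
  have t0 : 0 < t by rewrite lt_min ltr01 !divr_gt0 // mulr_gt0.
  have t1 : t <= 1 by rewrite ge_min lexx.
  have tg : t * cabs y <= (d / 2 - cabs (z - c)) * A.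
    by rewrite -ler_pdivlMr // ge_min lexx orbT.
  pose h : R[i] := - (t%:C * y) / dF c.
  have hA : cabs h * A = t * cabs y.
    rewrite /h normcM normcV normcN normcM cabs_real gtr0_norm //.
    by rewrite -mulrA mulVf ?mulr1 // gt_eqF.
  have ha : h * dF c = - (t%:C * y) by rewrite /h divfK.
  clearbody h t.
  have hd : cabs h <= d / 2 - cabs (z - c) by rewrite -(ler_pM2r A0) hA.
  have zh : cabs (z + h - c) <= d / 2.
    by rewrite addrAC; apply: le_trans (cabsD _ _) _; lra.
  have := hz _ zh; rewrite leNgt => /negP; apply.
  have -> : F (z + h) - w = h * (dquot F dF z (z + h) - dF c) + (1 - t)%:C * y.
    rewrite (dquotE F dF z (z + h)) (_ : z + h - z = h); last by ring.
    by rewrite mulrBr ha rmorphB /= /y; ring.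
  apply: le_lt_trans (cabsD _ _) _; rewrite !normcM cabs_real ger0_norm ?subr_ge0 //.
  have zh' : cabs (z + h - c) < d by apply: le_lt_trans zh _; lra.
  have : cabs h * cabs (dquot F dF z (z + h) - dF c) <= cabs h * (A / 2).
    by rewrite ler_wpM2l ?cabs_ge0 // near.
  have : 0 < t * cabs y by rewrite mulr_gt0.
  rewrite -/y; lra.
exists G => w ws; have [Gd FG] := hG w ws; split=> //; first exact: lt_le_trans Gd dr.
have close v : cabs (v - F c) < s -> A / 2 * cabs (G v - G w) <= cabs (v - w).
  move=> vs; have [Gv FGv] := hG v vs.
  by have := expand (G w) (G v) Gd Gv; rewrite FG FGv.
have cG : {for w, continuous G}.
  apply/continuous_atP => e e0.
  exists (Order.min (s - cabs (w - F c)) (A / 2 * e)).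
    by rewrite lt_min subr_gt0 ws mulr_gt0 // divr_gt0.
  move=> v; rewrite lt_min => /andP[h1 h2].
  rewrite -(ltr_pM2l (_ : 0 < A / 2)); last by rewrite divr_gt0.
  by apply: le_lt_trans h2; apply: close; have := cabs_distD w v (F c); lra.
pose q := dquot F dF (G w).
have qw v : cabs (v - F c) < s -> q (G v) != 0.
  move=> vs; rewrite -cabs_gt0; apply: lt_le_trans (far _ _ Gd (proj1 (hG v vs))).
  by rewrite divr_gt0.
(* Solving [F (G v) = F (G w) + (G v - G w) q (G v)] for [G v] displays the Caratheodory quotient of
   [G]. *)
exists (q (G w))^-1.
apply: (@has_deriv_near _ (fun v => G w + (v - w) * (q (G v))^-1)).
  apply/nbhs_diskP; exists (s - cabs (w - F c)); first by rewrite subr_gt0.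
  move=> v; rewrite /disk /mkset => hv.
  have vs : cabs (v - F c) < s by have := cabs_distD w v (F c); lra.
  have := dquotE F dF (G w) (G v); rewrite (proj2 (hG v vs)) FG -/q => E.
  rewrite {1}E [w + _]addrC addrK mulfK; last exact: qw.
  by rewrite addrC subrK.
exists (fun v => (q (G v))^-1); split.
- by move=> v; rewrite subrr mul0r addr0.
- have cqG : {for w, continuous (q \o G)}.
    apply: continuous_comp cG _; apply: dquot_continuous; apply: hF.
    exact: lt_le_trans Gd dr.
  apply: (@cvgV _ _ _ _ (q \o G)) cqG; exact: qw.
- by [].
Qed.

(** For [V] a disk this is a schlicht disk in the range of [F], before normalisation to the unit
    disk. *)
Definition holomorphic_right_inverse F G (U V : R[i] -> Prop) :=
  forall w, V w -> [/\ U (G w), F (G w) = w & exists a, has_deriv G w a].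

(* Choose a zero p of Re F nearly maximising (r/2 - |z - c|) |F' z|. Near p the
   derivative is then at most 4 |F' p| on the zeros of Re F, hence at most
   16 |F' p| everywhere, and Landau's theorem applies at p. The constant is
   kept as a product because numerals of R are unary. *)
Lemma derivative_bound_of_schlicht F dF c r B : 0 < r -> 0 <= B ->
  (forall z, cabs (z - c) < r -> has_deriv F z (dF z)) ->
  complex.Re (F c) = 0 ->
  (forall p d G, cabs (p - c) < r -> complex.Re (F p) = 0 -> 0 < d ->
    holomorphic_right_inverse F G (disk c r) (disk (F p) d) -> d <= B) ->
  cabs (dF c) * r <= 128 * 512 * B.
Proof.
move=> r0 B0 hF Fc hB.
have r3 : 0 < r / 4 by rewrite divr_gt0.
have [||v /= vr hv] := compact_max (u := fun z => cabs (F z)) _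
  (@closed_disk_compact _ c (3 * r / 4)).
- by exists c; rewrite /= subrr normc0; lra.
- move=> z /= zr; apply: Rcontinuous_at_cabs.
  by apply: (has_deriv_continuous (a := dF z)); apply: hF; lra.
set K := cabs (F v) in hv.
(* A Cauchy estimate obtained from Schwarz; it serves to make the supremum of [S] finite. *)
have cauchy z : cabs (z - c) < r / 2 -> cabs (dF z) <= 2 * K / (r / 4).
  move=> zr; rewrite ler_pdivlMr //.
  have sub w : cabs (w - z) < r / 4 -> cabs (w - c) <= 3 * r / 4.
    by move=> wz; have := cabs_distD z w c; lra.
  have dd w : cabs (w - c) <= 3 * r / 4 -> has_deriv (fun w => F w - F z) w (dF w - 0).
    by move=> wr; apply: has_derivB (has_deriv_cst _ _); apply: hF; lra.
  have := @schwarz _ (fun w => F w - F z) z (dF z - 0) (r / 4) (2 * K) r3.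
  rewrite subr0 => /(_ _ _ _ _)/wrap[||||[]//].
  - apply: holomorphic_disk_almost => w /sub wr; eexists; exact: dd w wr.
  - move=> w /sub wr; apply: le_trans (cabsB _ _) _.
    rewrite mulr_natl mulr2n lerD // hv //=; lra.
  - by rewrite subrr.
  - by rewrite -[X in has_deriv _ _ X]subr0; apply: dd; lra.
have [->|nc] := eqVneq (dF c) 0.
  rewrite normc0 mul0r; apply: mulr_ge0 B0; apply: mulr_ge0; exact: ler0n.
pose S := [set x | exists z, [/\ cabs (z - c) < r / 2, complex.Re (F z) = 0 &
  x = (r / 2 - cabs (z - c)) * cabs (dF z)]].
have Sc : S (r / 2 * cabs (dF c)).
  by exists c; rewrite subrr normc0 subr0; split=> //; lra.
have supS : has_sup S.
  split; first by exists (r / 2 * cabs (dF c)).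
  exists (r / 2 * (2 * K / (r / 4))) => _ [z [zr _ ->]].
  apply: ler_pM; [by rewrite subr_ge0 ltW|exact: cabs_ge0| |exact: cauchy].
  by rewrite gerBl cabs_ge0.
set m := sup S.
have mc : r / 2 * cabs (dF c) <= m by exact: sup_upper_bound.
have m0 : 0 < m by apply: lt_le_trans mc; rewrite mulr_gt0 ?divr_gt0 // cabs_gt0.
have [_ [p [pr Fp ->]]] := sup_adherent (divr_gt0 m0 (ltr0n _ 2)) supS.
rewrite -/m => hp; set R0 := r / 2 - cabs (p - c) in hp; set A := cabs (dF p) in hp.
have R00 : 0 < R0 by rewrite subr_gt0.
have A0 : 0 < A.
  have : 0 < R0 * A by apply: lt_trans hp; lra.
  by rewrite pmulr_rgt0.
(* Within [R0 / 2] of [p] the weight is at least [R0 / 2], while [m < 2 R0 A]; the quotient is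
   [4 A]. *)
have bz z : cabs (z - p) < R0 / 2 -> complex.Re (F z) = 0 -> cabs (dF z) <= 4 * A.
  move=> zp Fz; have tri := cabs_distD p z c.
  have zr : R0 / 2 <= r / 2 - cabs (z - c) by rewrite /R0 in zp *; lra.
  have zr' : cabs (z - c) < r / 2 by lra.
  have : (r / 2 - cabs (z - c)) * cabs (dF z) <= m.
    by apply: sup_upper_bound => //; exists z.
  have : R0 / 2 * cabs (dF z) <= (r / 2 - cabs (z - c)) * cabs (dF z).
    by rewrite ler_wpM2r ?cabs_ge0.
  move=> h1 h2; rewrite -(ler_pM2l R00); lra.
have inr z : cabs (z - p) < R0 -> cabs (z - c) < r.
  by move=> zp; have := cabs_distD p z c; rewrite /R0 in zp *; lra.
have bz' z : cabs (z - p) < R0 / 8 -> cabs (dF z) <= 16 * A.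
  move=> zp.
  (* The disk of radius [R0 / 4] about [z] contains the zero [p] and stays where [bz] applies. *)
  have sub w : cabs (w - z) < R0 / 4 -> cabs (w - p) < R0 / 2.
    by move=> wz; have := cabs_distD z w p; lra.
  have -> : 16 * A = 4 * (4 * A) by ring.
  apply: (@deriv_bound_zero _ F dF z (R0 / 4) _ p) => //.
  - by move=> w /sub wp; apply/hF/inr; lra.
  - by move=> w /sub; exact: bz.
  - by rewrite cabs_distC; lra.
have R08 : 0 < R0 / 8 by rewrite divr_gt0.
have [||G hG] := @landau F dF p (R0 / 8) (16 * A) R08 _ _ bz'.
- by rewrite -cabs_gt0.
- by move=> z zp; apply/hF/inr; lra.
have sE : A ^+ 2 * (R0 / 8) / (128 * (16 * A)) = R0 * A / (128 * 128).
  by field; rewrite gt_eqF.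
have h : R0 * A / (128 * 128) <= B.
  apply: (hB p _ G _ Fp).
  - by apply: inr; rewrite subrr normc0.
  - by apply: divr_gt0; apply: mulr_gt0 => //; rewrite ltr0n.
  - move=> w; rewrite /disk /mkset -sE => wp; have [h1 h2 h3] := hG w wp.
    by split=> //; apply: inr; lra.
(* The constant: [r |F' c| <= 2 m < 4 R0 A] and [R0 A <= 128 * 128 * B]. *)
rewrite ler_pdivrMr in h; last by rewrite mulr_gt0 // ltr0n.
lra.
Qed.

End Landau.

(** * The complex derivative and the differential of normed modules *)

Section Bridge.
Variable R : realType.
Implicit Types (F : R[i] -> R[i]) (z w a : R[i]).

(** The right-hand side is the limit defining the directional derivative along 1, which determines
    the differential on [R[i]]. *)
Lemma has_deriv_cvgP F z a : has_deriv F z a <->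
  (fun h => h^-1 *: ((F \o shift z) (h *: (1 : R[i])) - F z)) @ 0^' --> a.
Proof.
split.
- move=> /has_derivP h A /nbhs_diskP[e e0 sA].
  have [|d d0 hd] := h (e / 2); first by rewrite divr_gt0.
  apply/nbhs_diskP; exists d => // w; rewrite /disk /mkset subr0 => wd w0.
  apply: sA; rewrite /disk /mkset /= [w *: 1]mulr1.
  have := hd (w + z); rewrite addrK  => /(_ wd) hd'.
  have cw : 0 < cabs w by rewrite cabs_gt0.
  have -> : w^-1 *: (F (w + z) - F z) - a = w^-1 * (F (w + z) - F z - w * a).
    by rewrite mulrBr mulKf.
  rewrite normcM normcV mulrC ltr_pdivrMr //; apply: le_lt_trans hd' _.
  by rewrite ltr_pM2r // ltr_pdivrMr // ltr_pMr // ltr1n.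
- move=> h; apply/has_derivP => e e0.
  have /h/nbhs_diskP[d d0 hd] : nbhs a (disk a e) by apply/nbhs_diskP; exists e.
  exists d => // w wd; have [->|wz] := eqVneq w z.
    by rewrite !subrr mul0r subrr !normc0 mulr0.
  have cw : 0 < cabs (w - z) by rewrite cabs_gt0 subr_eq0.
  have := hd (w - z); rewrite /disk /mkset /= subr0 => /(_ wd).
  rewrite subr_eq0 => /(_ wz); rewrite /= [(w - z) *: 1]mulr1 subrK.
  have -> : (w - z)^-1 *: (F w - F z) - a = (w - z)^-1 * (F w - F z - (w - z) * a).
    by rewrite [RHS]mulrBr mulKf // subr_eq0.
  by rewrite normcM normcV mulrC ltr_pdivrMr // => /ltW.
Qed.

Lemma differentiable_has_deriv F z : differentiable F z -> has_deriv F z ('d F z 1).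
Proof.
move=> dF; apply/has_deriv_cvgP; rewrite -deriveE //.
by have /derivable1_diffP := dF.
Qed.

Lemma has_deriv_differentiable F z a : has_deriv F z a ->
  differentiable F z /\ 'd F z 1 = a.
Proof.
move=> /has_deriv_cvgP h.
have dF : derivable F z 1 by apply/cvg_ex; exists a.
have dF' : differentiable F z by exact/derivable1_diffP.
split=> //; rewrite -deriveE //.
by apply: cvg_lim h.
Qed.

End Bridge.

(** * Holomorphic maps of the plane and analytic disks *)

Section AnalyticDisks.
Variables (R : realType) (V : normedModType R[i]) (M : complexAtlas V).
Implicit Types (f : M -> complex_plane R) (phi h : complex_plane R -> M).

Lemma plane_holomorphic_on (g : complex_plane R -> complex_plane R) (U : set R[i]) :
  (forall z, U z -> exists a, has_deriv g z a) -> holomorphic_on g U.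
Proof.
move=> hg; split.
  by move=> z /set_mem /hg[a]; exact: has_deriv_continuous.
by move=> x y z Uz _ _; have [a /has_deriv_differentiable[]] := hg z Uz.
Qed.

Lemma plane_holomorphic_onP (g : complex_plane R -> complex_plane R) (U : set R[i]) z :
  holomorphic_on g U -> U z -> exists a, has_deriv g z a.
Proof.
move=> [_ hg] Uz; exists ('d g z 1); apply: differentiable_has_deriv.
exact: (hg z z z Uz).
Qed.

Lemma holomorphic_on_comp_plane (W : normedModType R[i]) (N : complexAtlas W)
    (phi : complex_plane R -> N) (g : R[i] -> R[i]) (A B : set R[i]) :
  holomorphic_on phi B ->
  (forall z, A z -> B (g z) /\ exists a, has_deriv g z a) ->
  holomorphic_on (phi \o g : complex_plane R -> N) A.
Proof.
move=> [cphi dphi] hg; split.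
  move=> z /set_mem Az; have [Bgz [a da]] := hg z Az.
  apply: continuous_comp; first exact: has_deriv_continuous da.
  by apply: cphi; exact: mem_set.
move=> x y z Az _ yd; have [Bgz [a /has_deriv_differentiable[dg _]]] := hg z Az.
have := dphi (g z) y (g z) Bgz I yd => dphi'.
exact: (differentiable_comp dg dphi').
Qed.

(** Near [zeta] the disk stays in the preferred chart at [phi zeta], so [f \o phi] factors there
    through the chart and the chain rule applies. *)
Lemma has_deriv_disk_comp f phi zeta : holomorphic f -> analytic_disk phi ->
  cabs zeta < 1 ->
  has_deriv (f \o phi) zeta (differential f (disk_derivative phi zeta)).
Proof.
move=> [cf df] [cphi dphi] zeta1.
have Uz : unit_disk R zeta by rewrite /unit_disk /disk /mkset subr0.
set x := phi zeta; pose c := chart_at x.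
have xc : chart_dom c x := chart_at_dom x.
have dphi' : differentiable (chart_coord c \o phi : R[i] -> V) zeta.
  exact: (dphi zeta x zeta Uz I xc).
have df' : differentiable (f \o chart_param c) (chart_coord c x).
  exact: (df x (f x) x I xc I).
have dcomp := differentiable_comp dphi' df'.
have := differentiable_has_deriv dcomp.
rewrite (diff_comp dphi' df') /=.
apply: has_deriv_near.
have : nbhs zeta (phi @^-1` chart_dom c).
  apply: (cphi zeta (mem_set Uz)); apply: open_nbhs_nbhs; split=> //.
  exact: dom_open.
apply: filterS => w wc /=; by rewrite coordK.
Qed.

End AnalyticDisks.

(** * From semi-Bloch to bounded derivatives, and on to bounded schlicht disks *)

Section Equivalences.
Variables (R : realType) (V : normedModType R[i]) (M : complexAtlas V).
Implicit Types (f : M -> complex_plane R) (phi h : complex_plane R -> M)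
  (lambda : R[i]) (L : set R[i]).

Definition exp_map f lambda : M -> riemann_sphere R :=
  fun z => Some (expC (lambda * f z)).

Lemma has_deriv_exp_scale lambda (w : R[i]) :
  has_deriv (fun w => expC (lambda * w)) w (expC (lambda * w) * (lambda * 1)).
Proof.
apply: (@has_deriv_comp _ (@expC R) (fun w => lambda * w)).
  exact: has_derivZ (has_deriv_id w).
exact: has_deriv_expC.
Qed.

Lemma exp_map_holomorphic f lambda : holomorphic f ->
  holomorphic (exp_map f lambda).
Proof.
move=> [cf df].
have dE w := proj1 (has_deriv_differentiable (has_deriv_exp_scale lambda w)).
split.
  move=> z zT; have cE := has_deriv_continuous (has_deriv_exp_scale lambda (f z)).
  have cEf : {for z, continuous ((fun w => expC (lambda * w)) \o f)}.
    by apply: continuous_comp (cf z zT) _; exact: cE.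
  apply: continuous_comp cEf _.
  exact: one_point_compactification_some_continuous.
move=> x y z _ zx zy; have df' := df x (f z) z I zx I.
case: y zy => [v|] _.
  exact: (differentiable_comp df' (dE _)).
(* In the chart at infinity the map is the reciprocal of the exponential, which never vanishes. *)
set v := in_charts f x (f z) (chart_coord (chart_at x) z) in df'.
have [dI _] := has_deriv_differentiable (@has_deriv_inv _ (fun w => expC (lambda * w)) v _
  (expC_neq0 (lambda * v)) (has_deriv_exp_scale lambda v)).
exact: (differentiable_comp df' dI).
Qed.

Lemma exp_map_differential f lambda z (xi : tangent z) : holomorphic f ->
  differential (exp_map f lambda) xi =
    expC (lambda * f z) * (lambda * differential f xi) :> R[i].
Proof.
move=> [cf df].
have df' := df z (f z) z I (chart_at_dom z) I.
have fz : in_charts f z (f z) (chart_coord (chart_at z) z) = f z.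
  by rewrite /in_charts /= coordK //; exact: chart_at_dom.
rewrite -[in RHS]fz /differential.
set F := in_charts f z (f z) in df' *; set v := F _ in df' *.
have [dE E1] := has_deriv_differentiable (has_deriv_exp_scale lambda v).
transitivity ('d ((fun w => expC (lambda * w)) \o F)
  (chart_coord (chart_at z) z) xi : R[i]).
  by [].
have chain := diff_comp df' dE.
pose eta : R[i] := 'd F (chart_coord (chart_at z) z) xi.
transitivity ('d (fun w => expC (lambda * w)) v eta : R[i]).
  exact: (congr1 (fun h : V -> R[i] => h xi) chain).
rewrite -/eta.
transitivity ('d (fun w => expC (lambda * w)) v (eta *: (1 : R[i]))).
  by congr ('d _ _ _); rewrite [eta *: 1]mulr1.
transitivity (eta * (expC (lambda * v) * (lambda * 1))); last first.
  by rewrite -/eta; ring.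
by rewrite linearZ E1.
Qed.

Lemma kobayashi_ge0 z (xi : tangent z) : (0 <= kobayashi (M := M) xi)%E.
Proof.
apply: le_ereal_inf_tmp => _ [a _ <-].
by rewrite lee_fin invr_ge0 cabs_ge0.
Qed.

Lemma spherical_exp_map f lambda z (xi : tangent z) : holomorphic f ->
  spherical_metric (differential (exp_map f lambda) xi) =
  2 * expR (complex.Re (lambda * f z)) * cabs (lambda * differential f xi) /
    (1 + expR (complex.Re (lambda * f z)) ^+ 2).
Proof.
move=> hf; transitivity (2 * cabs (differential (exp_map f lambda) xi : R[i]) /
  (1 + cabs (expC (lambda * f z)) ^+ 2)); first by [].
by rewrite exp_map_differential // normcM cabs_expC mulrA.
Qed.

Lemma nnsup_lty (A : set (\bar R)) (c : R) : 0 <= c ->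
  (forall x, A x -> (x <= c%:E)%E) -> (nnsup A < +oo)%E.
Proof.
move=> c0 hA; apply: (@le_lt_trans _ _ c%:E); last exact: ltry.
by apply: ge_ereal_sup => x [->|/hA //]; rewrite lee_fin.
Qed.

Lemma nnsup_lty_bound (A : set (\bar R)) : (nnsup A < +oo)%E ->
  exists2 c : R, 0 <= c & forall x, A x -> (x <= c%:E)%E.
Proof.
move=> As; have A0 : (0 <= nnsup A)%E by apply: ereal_sup_ubound; left.
exists (fine (nnsup A)); first exact: fine_ge0.
move=> x Ax; rewrite fineK; last by rewrite ge0_fin_numE.
by apply: ereal_sup_ubound; right.
Qed.

Lemma semi_bloch_sup_derivative f : holomorphic f -> semi_bloch f ->
  forall L, is_line L -> (sup_derivative f L < +oo)%E.
Proof.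
move=> hf sb L [a [b [b0 ->]]].
(* Multiplication by ['i / b] turns the direction of [L] into the imaginary one, so
   [|exp (lambda w)|] is constant on [L]. *)
pose lambda : R[i] := 'i / b.
have lambda0 : lambda != 0.
  rewrite mulf_neq0 ?invr_eq0 //; apply/eqP => /(congr1 (@complex.Im R)) /= /eqP.
  by rewrite oner_eq0.
have [_ [C hC]] := sb lambda.
pose e := expR (complex.Re (lambda * a)).
have e0 : 0 < e by exact: expR_gt0.
have onL t : complex.Re (lambda * (a + t%:C * b)) = complex.Re (lambda * a).
  have -> : lambda * (a + t%:C * b) = lambda * a + 'i * t%:C.
    by rewrite /lambda; field.
  by rewrite ReD Re_mul /=; ring.
pose k := 2 * e * cabs lambda / (1 + e ^+ 2).
have k0 : 0 < k.
  by rewrite divr_gt0 ?mulr_gt0 ?cabs_gt0 // ltr_wpDr ?sqr_ge0.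
apply: (@nnsup_lty _ (`|C| / k)); first by rewrite divr_ge0 // ltW.
move=> _ [z [xi [[t _ fz] ->]]].
have := hC z xi; rewrite -/(exp_map f lambda) (spherical_exp_map lambda xi hf).
rewrite -fz onL -/e normcM.
set d := cabs (differential f xi).
have -> : 2 * e * (cabs lambda * d) / (1 + e ^+ 2) = k * d by rewrite /k; ring.
have d0 : 0 <= d by exact: cabs_ge0.
(* If the metric vanishes at [xi], normality forces [d = 0] and the quotient is [0 * +oo = 0]; if it
   is infinite, the quotient is [d * 0 = 0]. *)
have := kobayashi_ge0 xi; case: (kobayashi xi) => [y| |//] y0.
- rewrite -EFinM lee_fin => h; have [yE|ny] := eqVneq y 0.
    have d00 : d = 0.
      apply/eqP; rewrite eq_le d0 andbT -(ler_pM2l k0) mulr0.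
      by rewrite yE mulr0 in h.
    by rewrite d00 mul0e lee_fin divr_ge0 // ltW.
  rewrite lee_fin in y0; have yp : 0 < y by rewrite lt_neqAle eq_sym ny.
  rewrite inver (negPf ny) -EFinM lee_fin ler_pdivrMr // mulrAC ler_pdivlMr //.
  rewrite mulrC; apply: le_trans h _; rewrite ler_wpM2r //; exact: ler_norm.
- by move=> _; rewrite invey mule0 lee_fin divr_ge0 // ltW.
Qed.

Lemma sup_derivative_schlicht f : kobayashi_nondegenerate M -> holomorphic f ->
  (forall L, is_line L -> (sup_derivative f L < +oo)%E) ->
  forall L, is_line L -> (sup_schlicht_radius f L < +oo)%E.
Proof.
move=> hM hf hd L /hd /nnsup_lty_bound[c c0 hc].
apply: (nnsup_lty c0) => _ [z /= Lz <-].
apply: ge_ereal_sup => _ [->|[r [r0 [h [hh [g [_ gh fh hf']]]]] <-]].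
  by rewrite lee_fin.
have in_disk (w : R[i]) : unit_disk R w -> disk (f z) r (f z + r%:C * w).
  rewrite /unit_disk /disk /mkset subr0 addrC addKr normcM cabs_real gtr0_norm // => w1.
  by rewrite gtr_pMr.
(* [h 0] need not lie over the centre of the disk; reparametrising by the inverse [g] makes
   [f \o phi] the affine map centred at [f z]. The point [phi 0] may differ from [z], but it has the
   same image on [L]. *)
pose phi : complex_plane R -> M := h \o (fun w => g (f z + r%:C * w)).
have aff (w : R[i]) : has_deriv (fun w => f z + r%:C * w) w r%:C.
  have := has_derivD (has_deriv_cst (f z) w) (has_derivZ r%:C (has_deriv_id w)).
  by rewrite add0r mulr1.
have hphi : analytic_disk phi.
  apply: (holomorphic_on_comp_plane hh) => w w1.
  have dw := in_disk w w1; split; first by have [] := hf' _ dw.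
  have [a da] := plane_holomorphic_onP gh dw.
  by eexists; exact: has_deriv_comp (aff w) da.
have fphi (w : R[i]) : unit_disk R w -> f (phi w) = f z + r%:C * w.
  by move=> /in_disk/hf'[].
have U0 : unit_disk R (0 : R[i]) by rewrite /unit_disk /disk /mkset subr0 normc0.
have fphi0 : f (phi 0) = f z by rewrite fphi // mulr0 addr0.
pose xi := disk_derivative phi 0.
have dxi : differential f xi = r%:C :> R[i].
  have h1 := has_deriv_disk_comp hf hphi (zeta := 0).
  have {}h1 := h1 (eq_ind_r (fun x => is_true (x < 1)) ltr01 (normc0 R)).
  apply: (has_deriv_unique h1); apply: has_deriv_disk (aff 0); first exact: ltr01.
  by move=> w /fphi.
have xi0 : xi != 0.
  apply/eqP => x0; move: dxi; rewrite x0 /differential linear0 =>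
    /(congr1 (@complex.Re R)) /=.
  by move=> r00; move: r0; rewrite -r00 ltxx.
have kpos := hM _ xi xi0.
(* [phi] itself competes in the infimum, with [a = 1]. *)
have k1 : (kobayashi xi <= 1%:E)%E.
  apply: ereal_inf_lbound; exists 1; last by rewrite cabs1 invr1.
  by split; [exact: oner_neq0|exists phi; split=> //; rewrite scale1r].
have := hc ((cabs (differential f xi))%:E / kobayashi xi)%E.
have -> : cabs (differential f xi) = r by rewrite dxi cabs_real gtr0_norm.
move=> /(_ _)/wrap[|].
  by exists (phi 0), xi; rewrite fphi0 dxi cabs_real gtr0_norm.
move: kpos k1; case: (kobayashi xi) => [y| |] //; rewrite !(lte_fin, lee_fin) => y0 y1.
rewrite inver gt_eqF // -EFinM !lee_fin; apply: le_trans.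
by rewrite ler_pdivlMr // ler_piMr // ltW.
Qed.

End Equivalences.

(** * From bounded schlicht disks to normality *)

Section SchlichtToNormal.
Variables (R : realType).

(** A zero of [Re F] in the half disk is the centre of a disk of radius 1/2 inside the unit disk, so
    the derivative there is at most [2 K] with [K = 128 * 512 * B], and [deriv_bound_zero] yields
    [8 K] at 0. Without such a zero, [deriv_bound_no_zero] on radius 1/2 yields the other term. *)
Lemma derivative_bound_at_center (F dF : R[i] -> R[i]) (B : R) : 0 <= B ->
  (forall z, cabs (z - 0) < 1 -> has_deriv F z (dF z)) ->
  (forall p d G, cabs (p - 0) < 1 -> complex.Re (F p) = 0 -> 0 < d ->
    holomorphic_right_inverse F G (disk 0 1) (disk (F p) d) -> d <= B) ->
  cabs (dF 0) <= 8 * (128 * 512 * B) + 4 * `|complex.Re (F 0)|.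
Proof.
move=> B0 hF hB.
have K0 : 0 <= 128 * 512 * B by apply: mulr_ge0 B0; apply: mulr_ge0; exact: ler0n.
have half : (0 : R) < 1 / 2 by rewrite divr_gt0.
have sub (p w : R[i]) : cabs (p - 0) < 1 / 2 -> cabs (w - p) < 1 / 2 -> cabs (w - 0) < 1.
  by move=> pr wp; have := cabs_distD p w 0; lra.
have zero p : cabs (p - 0) < 1 / 2 -> complex.Re (F p) = 0 ->
    cabs (dF p) <= 2 * (128 * 512 * B).
  move=> pr Fp.
  have := @derivative_bound_of_schlicht _ F dF p (1 / 2) B half B0.
  move: (128 * 512 * B) => K /(_ _ Fp _)/wrap[||h]; last by lra.
  - by move=> w wp; apply: hF; exact: sub pr wp.
  - move=> q d G qp Fq d0 hG; apply: (hB q d G) => //; first exact: sub pr qp.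
    move=> w /hG[Gw FG dG]; split=> //; exact: sub pr Gw.
move: (128 * 512 * B) K0 zero => K K0 zero.
have hF' z : cabs (z - 0) < 1 / 2 -> has_deriv F z (dF z).
  by move=> zr; apply: hF; lra.
have [[p [pr Fp]]|nz] := pselect (exists p, cabs (p - 0) < 1 / 2 /\ complex.Re (F p) = 0).
  have h := deriv_bound_zero hF' zero pr Fp.
  have := normr_ge0 (complex.Re (F 0)); lra.
have := deriv_bound_no_zero half hF'; move=> /(_ _)/wrap[|]; last by lra.
by move=> z zr; apply/eqP => Fz; apply: nz; exists z.
Qed.

Variables (V : normedModType R[i]) (M : complexAtlas V).
Implicit Types (f : M -> complex_plane R) (phi h : complex_plane R -> M).

(** Following the branch [G] by [phi] gives a disk in [M] on which [lambda f] is affine; dividing by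
    [lambda] scales the radius. *)
Lemma schlicht_disk_of_right_inverse f phi (lambda p : R[i]) (d : R) G :
  lambda != 0 -> holomorphic f -> analytic_disk phi -> 0 < d ->
  holomorphic_right_inverse (fun z => lambda * f (phi z)) G (disk 0 1)
    (disk (lambda * f (phi p)) d) ->
  schlicht_disk f (f (phi p)) (d / cabs lambda).
Proof.
move=> l0 hf hphi d0 hG; have cl0 : 0 < cabs lambda by rewrite cabs_gt0.
set r := d / cabs lambda; have r0 : 0 < r by rewrite divr_gt0.
split=> //; set w0 := f (phi p).
pose aff (w : R[i]) := lambda * (w0 + r%:C * w).
have daff w : has_deriv aff w (lambda * (r%:C * 1)).
  have := has_derivD (has_deriv_cst w0 w) (has_derivZ r%:C (has_deriv_id w)).
  by rewrite add0r; exact: has_derivZ.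
have in_disk w : unit_disk R w -> disk (lambda * w0) d (aff w).
  rewrite /unit_disk /disk /mkset subr0 /aff mulrDr addrC addKr => w1.
  rewrite !normcM cabs_real gtr0_norm // mulrA /r [cabs lambda * _]mulrC divfK ?gt_eqF //.
  by rewrite gtr_pMr.
pose h : complex_plane R -> M := phi \o (G \o aff).
have hh : analytic_disk h.
  apply: (holomorphic_on_comp_plane hphi) => w /in_disk/hG[Gw _ [a da]].
  split; first exact: Gw.
  by eexists; exact: has_deriv_comp (daff w) da.
have fh w : unit_disk R w -> f (h w) = w0 + r%:C * w.
  move=> /in_disk/hG[_ E _]; apply: (mulfI l0); exact: E.
exists h; split=> //; exists (fun w => (w - w0) / r%:C).
have rC0 : r%:C != 0 :> R[i] by rewrite -cabs_gt0 cabs_real normr_gt0 gt_eqF.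
have U w : disk w0 r w -> unit_disk R ((w - w0) / r%:C).
  rewrite /unit_disk /disk /mkset subr0 normcM normcV cabs_real gtr0_norm //.
  by rewrite ltr_pdivrMr // mul1r.
split.
- apply: plane_holomorphic_on => w w1; exists (differential f (disk_derivative h w)).
  apply: has_deriv_disk_comp => //; move: w1; by rewrite /unit_disk /disk /mkset subr0.
- apply: plane_holomorphic_on => w _.
  exists (1 * r%:C^-1 + (w - w0) * 0).
  exact: has_derivM (has_deriv_sub w0 w) (has_deriv_cst _ _).
- move=> w w1; rewrite /= fh // addrAC subrr add0r [_ / _]mulrC mulKf //; split=> //.
  rewrite /disk /mkset addrAC subrr add0r normcM cabs_real gtr0_norm // gtr_pMr //.
  by move: w1; rewrite /unit_disk /disk /mkset subr0.
- move=> w wr; split; first exact: U.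
  by rewrite /= fh; [rewrite mulrC divfK // addrC subrK|exact: U].
Qed.

(** A form of [|u| <= 2 cosh u]: it follows from [u <= expR u] when [u >= 0] and from
    [- u <= expR (- u)] when [u < 0]. *)
Lemma expR_growth (u : R) : 2 * expR u * `|u| <= 2 * (1 + expR u ^+ 2).
Proof.
have e0 := expR_gt0 u; have [u0|u0] := leP 0 u.
  rewrite ger0_norm //; have : expR u * u <= expR u * expR u.
    by rewrite ler_pM2l //; have := expR_ge1Dx u; lra.
  by rewrite expr2; lra.
rewrite ltr0_norm //.
have : expR u * - u <= expR u * expR (- u).
  by rewrite ler_pM2l //; have := expR_ge1Dx (- u); lra.
rewrite -expRD subrr expR0; have := sqr_ge0 (expR u); lra.
Qed.

Lemma sup_schlicht_radius_semi_bloch f : holomorphic f ->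
  (forall L, is_line L -> (sup_schlicht_radius f L < +oo)%E) -> semi_bloch f.
Proof.
move=> hf hd lambda; split; first exact: exp_map_holomorphic.
have [l0|l0] := eqVneq lambda 0.
  exists 0 => z xi; rewrite -/(exp_map f lambda) spherical_exp_map // l0 !mul0r mul0e.
  by rewrite normc0 mulr0 mul0r.
(* This is the line [Re (lambda w) = 0], where the zeros of [Re F] are sent by [f \o phi]. *)
pose L := [set 0 + t%:C * ('i / lambda) | t in [set: R]].
have iL : is_line L.
  exists 0, ('i / lambda); split=> //; rewrite mulf_neq0 ?invr_eq0 //.
  by apply/eqP => /(congr1 (@complex.Im R)) /= /eqP; rewrite oner_eq0.
have [B B0 hB] := nnsup_lty_bound (hd L iL).
have cl0 : 0 < cabs lambda by rewrite cabs_gt0.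
have inL (w : R[i]) : complex.Re (lambda * w) = 0 -> L w.
  move=> h; exists (complex.Im (lambda * w)) => //; rewrite add0r.
  apply: (mulfI l0); rewrite mulrCA [lambda * (_ / _)]mulrC divfK //.
  by move: h; case: (lambda * w) => x y /= ->; simpc.
have schB phi p d G : analytic_disk phi -> complex.Re (lambda * f (phi p)) = 0 ->
    0 < d ->
    holomorphic_right_inverse (fun z => lambda * f (phi z)) G (disk 0 1)
      (disk (lambda * f (phi p)) d) -> d <= B * cabs lambda.
  move=> hphi Fp d0 hG; rewrite -ler_pdivrMr // -lee_fin.
  apply: (@le_trans _ _ (schlicht_radius f (phi p))).
    apply: ereal_sup_ubound; right; exists (d / cabs lambda) => //.
    exact: schlicht_disk_of_right_inverse hG.
  by apply: hB; exists (phi p) => //; exact: inL.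
pose K := 128 * 512 * (B * cabs lambda).
have K0 : 0 <= K.
  apply: mulr_ge0; first by apply: mulr_ge0; exact: ler0n.
  by rewrite mulr_ge0 // ltW.
(* The derivative bound is [8 K + 4 |u|]. In the spherical metric its first term costs [8 K] since
   [2 expR u <= 1 + expR u ^+ 2], and its second costs 8 by [expR_growth]. *)
exists (8 * K + 8) => z xi; rewrite -/(exp_map f lambda) spherical_exp_map //.
set u := complex.Re (lambda * f z); set x := cabs (lambda * differential f xi).
have C0 : 0 < 8 * K + 8 by lra.
have e0 := expR_gt0 u.
have den : 0 < 1 + expR u ^+ 2 by rewrite ltr_wpDr ?sqr_ge0.
(* Dividing by the positive constant leaves a lower bound for an infimum, to be checked on each
   competing disk. *)
rewrite -lee_pdivrMl //.
apply: le_ereal_inf_tmp => _ [a [a0 [phi [hphi phi0 dphi]]] <-].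
have ca0 : 0 < cabs a by rewrite cabs_gt0.
rewrite -EFinM lee_fin mulrC ler_pdivrMr //.
rewrite [leRHS]mulrC ler_pdivlMr //.
pose F w := lambda * f (phi w).
pose dF w := lambda * differential f (disk_derivative phi w) : R[i].
have hF w : cabs (w - 0) < 1 -> has_deriv F w (dF w).
  rewrite subr0 => w1; apply: has_derivZ; exact: has_deriv_disk_comp.
have B0' : 0 <= B * cabs lambda by rewrite mulr_ge0 // ltW.
have := @derivative_bound_at_center F dF (B * cabs lambda) B0' hF.
rewrite -/K => /(_ _)/wrap[|].
  by move=> p d G _ Fp d0; exact: schB.
have -> : complex.Re (F 0) = u by rewrite /F phi0.
have -> : cabs (dF 0) = cabs a * x.
  rewrite /dF dphi {}/x; move: xi dphi; rewrite -phi0 => xi _.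
  have -> : differential f (a *: xi) = a * differential f xi :> R[i].
    by rewrite /differential linearZ.
  by rewrite mulrCA [cabs (a * _)]normcM.
move=> hx.
have g1 : 2 * expR u <= 1 + expR u ^+ 2.
  have := sqr_ge0 (expR u - 1); rewrite sqrrB1; lra.
have g2 := expR_growth u.
have g3 : 2 * expR u * (cabs a * x) <= 2 * expR u * (8 * K + 4 * `|u|).
  by rewrite ler_wpM2l // mulr_ge0 // ltW.
have g4 : 2 * expR u * (8 * K) <= (1 + expR u ^+ 2) * (8 * K).
  by rewrite ler_wpM2r // mulr_ge0.
rewrite mulrAC ler_pdivrMr //.
lra.
Qed.

End SchlichtToNormal.

Theorem theorem4p2 (R : realType) (n : nat)
    (M : complexManifold 'rV[R[i]]_n) (f : M -> complex_plane R)
    (hM : kobayashi_nondegenerate M) (hf : holomorphic f) :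
  (semi_bloch f <->
     (forall L : set R[i], is_line L -> (sup_derivative f L < +oo)%E)) /\
  (semi_bloch f <->
     (forall L : set R[i], is_line L -> (sup_schlicht_radius f L < +oo)%E)).
Proof.
have h12 := semi_bloch_sup_derivative hf.
have h23 := sup_derivative_schlicht hM hf.
have h31 := sup_schlicht_radius_semi_bloch hf.
by split; split=> h; [exact: h12|exact/h31/h23|exact/h23/h12|exact: h31].
Qed.
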